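(* Let $\theta$ be a positive number, let $W$ be a standard Wiener process, and let $u$ be the solution of the It\^o equation $$du(t,x)-\theta u_{xx}(t,x)\,dt=u(t,x)\,dW(t),\quad t>0,\ x\in(0,\pi),$$ with zero boundary conditions. Let $h_k(x)=\sqrt{2/\pi}\,\sin(kx)$, $u_k(t)=\int_0^\pi u(t,x)h_k(x)\,dx$, $k\ge 1$, so that $u(t,x)=\sum_{k\ge1}u_k(t)h_k(x)$, and assume that $u_k(0)\neq 0$ for all $k\geq 1$. If the solution is observed in the form $u(t,x)=\sum_{k\ge1}u_k(t)h_k(x)$, then $\theta$ can be computed in each of the following ways, each equality holding with probability one: (E1) $\displaystyle \theta=\lim_{T\to\infty}\left(\frac{1}{k^2T}\ln\frac{u_k(0)}{u_k(T)}-\frac{1}{2k^2}\right)$ for every $k\ge 1$; (E2) $\displaystyle \theta=\lim_{k\to\infty}\frac{1}{k^2T}\ln\frac{u_k(0)}{u_k(T)}$ for every $T>0$; (E3) $\displaystyle \theta=\frac{1}{T(k^2-n^2)}\ln\frac{u_n(T)\,u_k(0)}{u_k(T)\,u_n(0)}$ for every $T>0$ and $n\neq k$ ($n,k\geq 1$).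
   Context: $W$ is a standard Brownian motion on a stochastic basis satisfying the usual assumptions. For $\gamma\in\mathbb{R}$ let $\mathbf{H}^\gamma$ be the space of formal series $v=\sum_{k\ge1}v_kh_k$ with real coefficients and $\sum_{k\geq 1} (1+k^2)^{\gamma}|v_k|^2<\infty$ (for $\gamma=0$ this is $L_2(0,\pi)$). The initial condition $u(0,\cdot)$ is deterministic and belongs to $\mathbf{H}^\gamma$ for some $\gamma\in\mathbb{R}$. The solution $u$ is the unique adapted process, belonging for every $T>0$ to $L_2(\Omega;L_2((0,T);\mathbf{H}^{\gamma+1}))\cap L_2(\Omega;C([0,T];\mathbf{H}^{\gamma}))$, such that with probability one, for all $t\geq 0$, $u(t)-\theta\int_0^t u_{xx}(s)\,ds=u(0)+\int_0^t u(s)\,dW(s)$ in $\mathbf{H}^{\gamma-1}$. Here $\partial_{xx}$ acts on $\mathbf{H}^{\gamma+1}$ by $h_k\mapsto -k^2h_k$ (zero boundary conditions), and $u_k(t)$ is the coefficient of $u(t)$ at $h_k$, which is $\int_0^\pi u(t,x)h_k(x)\,dx$ when $u(t)\in L_2(0,\pi)$. *)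

(* Defs.v *)
From mathcomp Require Import all_boot all_order all_algebra.
From mathcomp Require Import all_classical all_reals all_analysis.
From mathcomp Require Import zify ring lra.

Set Implicit Arguments.
Unset Strict Implicit.
Unset Printing Implicit Defensive.
Import Order.TTheory GRing.Theory Num.Theory.
Import numFieldNormedType.Exports.
Local Open Scope classical_set_scope.
Local Open Scope ring_scope.

Definition hfun {R : realType} (k : nat) (x : R) : R :=
  Num.sqrt (2 / pi) * sin (k%:R * x).

Lemma sin_natpi {R : realType} (k : nat) : sin (k%:R * pi : R) = 0.
Proof.
elim: k => [|k IHk]; first by rewrite mul0r sin0.
by rewrite -natr1 mulrDl mul1r sinDpi IHk oppr0.
Qed.

Lemma hfun_dirichlet {R : realType} (k : nat) :
  hfun k (0 : R) = 0 /\ hfun k (pi : R) = 0.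
Proof.
rewrite /hfun mulr0 sin0 mulr0; split => //.
by rewrite sin_natpi mulr0.
Qed.

Lemma hfun_derive2 {R : realType} (k : nat) (x : R) :
  derive1 (derive1 (hfun k)) x = - k%:R ^+ 2 * hfun k x.
Proof.
have dk (y : R) : is_derive y 1 ( *%R k%:R : R -> R) k%:R.
  by apply: is_derive_eq; rewrite /GRing.scale/= mulr1.
have d1 : derive1 (hfun k) = fun y : R => Num.sqrt (2 / pi) * (cos (k%:R * y) * k%:R).
  apply/funext => y; rewrite derive1E.
  have := is_derive1_comp (is_derive_sin (k%:R * y)) (dk y) => d.
  have := is_deriveZ (Num.sqrt (2 / pi)) d => {}d.
  by have := @derive_val _ _ _ _ _ _ _ d.
rewrite d1 derive1E.
have := is_derive1_comp (is_derive_cos (k%:R * x)) (dk x) => d.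
have := is_deriveZ (Num.sqrt (2 / pi) * k%:R) d => {}d.
rewrite (_ : (fun y : R => _) =
    (Num.sqrt (2 / pi) * k%:R) \*: (cos \o *%R k%:R)); last first.
  by apply/funext => y /=; rewrite /GRing.scale/=; ring.
rewrite (@derive_val _ _ _ _ _ _ _ d) /hfun /GRing.scale/=; ring.
Qed.

Lemma hfun_orthonormal {R : realType} (j k : nat) : (1 <= j)%N -> (1 <= k)%N ->
  (\int[@lebesgue_measure R]_(x in `[0%R, pi]) (hfun j x * hfun k x)%:E)%E =
  (j == k)%:R%:E.
Proof.
move=> j1 k1.
have pi0 : (pi : R) != 0 by rewrite gt_eqF// pi_gt0.
pose S (a x : R) : R := if a == 0 then x else a^-1 * sin (a * x).
have dS (a x : R) : is_derive x 1 (S a) (cos (a * x)).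
  rewrite /S; case: eqVneq => [->|a0]; first by rewrite mul0r cos0; exact: is_derive_id.
  have da : is_derive x 1 ( *%R a : R -> R) a.
    by apply: is_derive_eq; rewrite /GRing.scale/= mulr1.
  have := is_deriveZ a^-1 (is_derive1_comp (is_derive_sin (a * x)) da).
  by move=> d; apply: is_derive_eq; rewrite /GRing.scale/= mulrCA mulVf// mulr1.
pose G : R -> R := pi^-1 \*: (S (j%:R - k%:R) - S (j%:R + k%:R)).
have dG (x : R) : is_derive x 1 G (hfun j x * hfun k x).
  have := is_deriveZ pi^-1 (is_deriveB (dS (j%:R - k%:R) x) (dS (j%:R + k%:R) x)).
  move=> d; apply: is_derive_eq.
  rewrite /GRing.scale/= mulrBl mulrDl cosB cosD /hfun.
  rewrite mulrACA -expr2 sqr_sqrtr ?divr_ge0 ?pi_ge0//.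
  have E (p c s : R) : p * (c + s - (c - s)) = 2 * p * s by ring.
  exact: E.
have cG : continuous G.
  move=> x; apply: differentiable_continuous; apply/derivable1_diffP.
  exact: (@ex_derive _ _ _ _ _ _ _ (dG x)).
rewrite (@continuous_FTC2 _ _ G) ?pi_gt0//.
- have Spi (i : R) : sin (i * pi) = 0 -> S i pi = (i == 0)%:R * pi.
    by rewrite /S; case: eqVneq => [_ _|_ ->]; rewrite ?mul1r ?mulr0 ?mul0r.
  have S0 (i : R) : S i 0 = 0 by rewrite /S mulr0 sin0 mulr0 if_same.
  rewrite -EFinB; congr (_%:E).
  rewrite /G /GRing.scale/= !fctE !S0 !Spi; last 2 first.
  + by rewrite mulrDl sinD !sin_natpi !(mul0r, mulr0) addr0.
  + by rewrite mulrBl sinB !sin_natpi !(mul0r, mulr0) subr0.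
  have -> : (j%:R + k%:R == 0 :> R) = false.
    by apply/negbTE; rewrite -natrD pnatr_eq0; lia.
  rewrite subr_eq0 eqr_nat mul0r !subr0 scaler0 subr0.
  by rewrite -[LHS]/(pi^-1 * _) mulrC -mulrA mulfV// mulr1.
- apply: continuous_subspaceT.
  have ch (i : nat) (x : R) : {for x, continuous (hfun i : R -> R)}.
    apply: (@continuousM R _ (cst _ : R -> R) (fun y => sin (i%:R * y)) x).
      exact: cst_continuous.
    apply: (@continuous_comp R R R ( *%R i%:R) sin x).
      exact: mulrl_continuous.
    exact: continuous_sin.
  by move=> x; apply: (@continuousM R _ (hfun j : R -> R) (hfun k : R -> R) x); exact: ch.
- split.
  + by move=> x _; exact: (@ex_derive _ _ _ _ _ _ _ (dG x)).
  + by apply: cvg_at_right_filter; exact: cG.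
  + by apply: cvg_at_left_filter; exact: cG.
- by move=> x _; rewrite derive1E (@derive_val _ _ _ _ _ _ _ (dG x)).
Qed.

(** The formal series [\sum_(k >= 1) v_k h_k], [h_k] being [hfun k], is identified
    with its sequence of coefficients; for a function in [L_2(0, pi)], [v k] is its
    inner product with [hfun k] ([hfun_orthonormal]).  Coefficients are numbered
    from 1: the value [v 0%N] carries no information, and everything below
    ignores it. *)
Definition fseries (R : realType) := nat -> R.

Definition eq_fseries {R : realType} (v w : fseries R) :=
  forall k, (1 <= k)%N -> v k = w k.

Definition Hnorm2 {R : realType} (g : R) (v : fseries R) : \bar R :=
  (\sum_(1 <= k <oo) ((1 + k%:R ^+ 2) `^ g * v k ^+ 2)%:E)%E.

Definition Hnorm {R : realType} (g : R) (v : fseries R) : \bar R :=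
  sqrte (Hnorm2 g v).

Definition inH {R : realType} (g : R) (v : fseries R) : Prop :=
  (Hnorm2 g v < +oo)%E.

Definition Hsub {R : realType} (v w : fseries R) : fseries R :=
  fun k => v k - w k.

(** The second derivative acts termwise, by [hfun_derive2]. *)
Definition dxx {R : realType} (v : fseries R) : fseries R :=
  fun k => - k%:R ^+ 2 * v k.

Definition Hopen {R : realType} (g : R) (U : set (fseries R)) : Prop :=
  forall v, inH g v -> U v -> exists2 r : R, 0 < r &
    forall w, inH g w -> (Hnorm g (Hsub w v) < r%:E)%E -> U w.

(** [X] takes its values in [H^g], and is measurable from [G] to the Borel
    sigma-algebra, which the open sets generate. *)
Definition Hmeasurable {R : realType} {Om : Type} (G : set (set Om)) (g : R)
    (X : Om -> fseries R) : Prop :=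
  (forall w, inH g (X w)) /\ (forall U, Hopen g U -> G (X @^-1` U)).

Definition Hcontinuous {R : realType} (g : R) (p : R -> fseries R) : Prop :=
  forall t, 0 <= t -> inH g (p t) /\
    Hnorm g (Hsub (p s) (p t)) @[s --> within [set s | 0 <= s] (nbhs t)] --> 0%E.

(** The step function [\sum_(i < sf_size) sf_val i * \1_(sf_set i)]. *)
Record step_fun (R : realType) := StepFun {
  sf_size : nat;
  sf_set : nat -> set R;
  sf_val : nat -> fseries R }.

Definition is_step_fun {R : realType} (g : R) (D : set R) (S : step_fun R) :=
  forall i, (i < sf_size S)%N ->
    [/\ measurable (sf_set S i), sf_set S i `<=` D,
        (@lebesgue_measure R (sf_set S i) < +oo)%E & inH g (sf_val S i)].

Definition step_fun_eval {R : realType} (S : step_fun R) (s : R) : fseries R :=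
  fun k => \sum_(i < sf_size S) \1_(sf_set S i) s * sf_val S i k.

Definition step_fun_int {R : realType} (S : step_fun R) : fseries R :=
  fun k => \sum_(i < sf_size S)
    fine (@lebesgue_measure R (sf_set S i)) * sf_val S i k.

Definition bochner_integral {R : realType} (g : R) (D : set R)
    (f : R -> fseries R) (J : fseries R) : Prop :=
  inH g J /\ exists S : nat -> step_fun R,
    [/\ forall n, is_step_fun g D (S n),
        {ae (@lebesgue_measure R), forall s, D s ->
           Hnorm g (Hsub (step_fun_eval (S n) s) (f s)) @[n --> \oo] --> 0%E},
        (\int[@lebesgue_measure R]_(s in D)
           Hnorm g (Hsub (step_fun_eval (S n) s) (f s)))%E @[n --> \oo] --> 0%E
      & Hnorm g (Hsub (step_fun_int (S n)) J) @[n --> \oo] --> 0%E].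

(** Time is [[0, +oo[]; filtrations and processes are indexed by all of [R], but
    their values at negative times are never used. *)
Definition usual_conditions {R : realType} {d : measure_display}
    {Om : measurableType d} (P : probability Om R)
    (F : R -> set (set Om)) : Prop :=
  [/\ forall t, 0 <= t -> sigma_algebra setT (F t) /\ F t `<=` measurable,
      forall s t, 0 <= s -> s <= t -> F s `<=` F t,
      forall t, 0 <= t -> \bigcap_(s in `]t, +oo[) F s `<=` F t
    & forall N, P.-negligible N -> F 0 N].

(** The second parameter of [normal_prob] is the standard deviation. *)
Definition brownian_motion {R : realType} {d : measure_display}
    {Om : measurableType d} (P : probability Om R)
    (F : R -> set (set Om)) (W : R -> Om -> R) : Prop :=
  [/\ {ae P, forall w, W 0 w = 0},
      {ae P, forall w, {within `[0, +oo[, continuous (W ^~ w)}},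
      forall t (B : set R), 0 <= t -> measurable B -> F t (W t @^-1` B),
      forall s t (B : set R), 0 <= s -> s < t -> measurable B ->
        P [set w | B (W t w - W s w)] = normal_prob 0 (Num.sqrt (t - s)) B
    & forall s t (A : set Om) (B : set R), 0 <= s -> s < t ->
        F s A -> measurable B ->
        P (A `&` [set w | B (W t w - W s w)]) =
          (P A * P [set w | B (W t w - W s w)%R])%E].

(** The process [\sum_(i < sp_size) sp_val i * \1_(]sp_time i, sp_time i.+1])]. *)
Record simple_process (R : realType) (Om : Type) := SimpleProcess {
  sp_size : nat;
  sp_time : nat -> R;
  sp_val : nat -> Om -> fseries R }.

Definition is_simple_process {R : realType} {Om : Type}
    (F : R -> set (set Om)) (g : R) (S : simple_process R Om) : Prop :=
  [/\ 0 <= sp_time S 0,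
      forall i, sp_time S i <= sp_time S i.+1
    & forall i, (i < sp_size S)%N ->
        Hmeasurable (F (sp_time S i)) g (sp_val S i) /\
        exists C : R, forall w, (Hnorm g (sp_val S i w) <= C%:E)%E].

Definition simple_eval {R : realType} {Om : Type} (S : simple_process R Om)
    (s : R) (w : Om) : fseries R :=
  fun k => \sum_(i < sp_size S)
    \1_(`]sp_time S i, sp_time S i.+1]%classic) s * sp_val S i w k.

Definition simple_int {R : realType} {Om : Type} (W : R -> Om -> R)
    (S : simple_process R Om) (t : R) (w : Om) : fseries R :=
  fun k => \sum_(i < sp_size S)
    sp_val S i w k * (W (Num.min t (sp_time S i.+1)) w
                      - W (Num.min t (sp_time S i)) w).

(** [I t = \int_0^t Phi dW] for all [t >= 0], in [H^g]: [I] is the adapted, almost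
    surely continuous process that is the mean-square limit of the integrals of
    simple processes converging to [Phi] in [L_2(Om x (0, T); H^g)].  [Phi] is
    meant to be jointly measurable up to null sets, which holds for adapted
    processes with almost surely continuous paths. *)
Definition ito_integral {R : realType} {d : measure_display}
    {Om : measurableType d} (P : probability Om R) (F : R -> set (set Om))
    (W : R -> Om -> R) (g : R) (Phi I : R -> Om -> fseries R) : Prop :=
  [/\ forall t, 0 <= t -> Hmeasurable (F t) g (I t),
      {ae P, forall w, Hcontinuous g (I ^~ w)}
    & forall T, 0 < T -> exists S : nat -> simple_process R Om,
        [/\ forall n, is_simple_process F g (S n),
            (\int[P]_w \int[@lebesgue_measure R]_(s in `[0%R, T])
               Hnorm2 g (Hsub (simple_eval (S n) s w) (Phi s w)))%E
              @[n --> \oo] --> 0%E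
          & forall t, 0 <= t -> t <= T ->
            (\int[P]_w Hnorm2 g (Hsub (simple_int W (S n) t w) (I t w)))%E
              @[n --> \oo] --> 0%E]].

Definition heat_solution {R : realType} {d : measure_display}
    {Om : measurableType d} (P : probability Om R) (F : R -> set (set Om))
    (W : R -> Om -> R) (theta g : R) (u : R -> Om -> fseries R) : Prop :=
  [/\ forall t, 0 <= t -> Hmeasurable (F t) g (u t),
      {ae P, forall w, Hcontinuous g (u ^~ w)},
      forall T, 0 < T -> (\int[P]_w \int[@lebesgue_measure R]_(s in `[0%R, T])
                            Hnorm2 (g + 1) (u s w) < +oo)%E,
      forall T, 0 < T ->
        (\int[P]_w ereal_sup [set Hnorm2 g (u s w) | s in `[0%R, T]] < +oo)%E
    & exists2 I : R -> Om -> fseries R, ito_integral P F W g u I &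
      {ae P, forall w, forall t, 0 <= t -> exists2 J : fseries R,
         bochner_integral (g - 1) `[0, t] (fun s => dxx (u s w)) J &
         eq_fseries (fun k => u t w k - theta * J k)
                    (fun k => u 0 w k + I t w k)}].

(* Main.v *)
From HB Require Import structures.
Require Import Defs.
From mathcomp Require Import all_boot all_order all_algebra.
From mathcomp Require Import all_classical all_reals all_analysis.
From mathcomp Require Import measurable_realfun lebesgue_integral_under.
From mathcomp Require Import ring lra.
Set Implicit Arguments.
Unset Strict Implicit.
Unset Printing Implicit Defensive.
Import Order.TTheory GRing.Theory Num.Theory.
Import numFieldNormedType.Exports.
Local Open Scope classical_set_scope.
Local Open Scope ring_scope.

(** Projected on [h_k], the equation becomes the scalar linear equation
    [dX = - lam X dt + X dW] with [lam = theta k^2], whose solution is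
    [u_k(t) = u_k(0) exp (W_t - W_0 - (lam + 1/2) t)] ([solution_coordinate]).
    Therefore [ln (u_k(0) / u_k(T)) = (theta k^2 + 1/2) T - (W_T - W_0)]: the
    Brownian path disappears when two coordinates are compared at the same time,
    is negligible after division by [k^2] as [k] grows, and is negligible after
    division by [T] as [T] grows because [W_T / T] tends to 0 almost surely
    ([brownian_growth]).

    The explicit formula is obtained without the Ito formula, by comparing local
    expansions.  Let [h = t - s] be small.  Both [X] and the exponential process
    satisfy
      [Z_t = (1 - lam h) Z_s + Z_s (W_t - W_s) + q + p],
    where [E p^2 = O(h^3)], [E q^2 = O(h^2)], and [q] is orthogonal to the square
    integrable variables known at time [s] ([expands]).  The relation is linear in
    [Z].  If [Z] satisfies it, then by orthogonality [E Z_t^2] exceeds [E Z_s^2] by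
    at most [K h E Z_s^2 + O(h^2)], so if moreover [Z_0 = 0] then summing over a grid
    of step [T / n] gives [E Z_T^2 = O(1 / n)], that is [Z_T = 0] ([expands_eq0]).
    For the exponential process the expansion reduces to the first moments of a
    Gaussian variable and of its exponential ([wick_linear]).  For [X], the term [p]
    comes from the drift, and [q] is the stochastic integral of [X_r - X_s] over
    [r] in [(s, t]]: its size and its orthogonality pass to the limit from step
    processes, where they follow from the covariance of products of Brownian
    increments ([mean_mul_increments], [ito_increment_sqr],
    [ito_increment_orthogonal]).

    The growth of Brownian motion comes from a maximal inequality, proved by freezing
    the sampled path when it leaves an interval ([stopped_sqr]), and from the
    Borel-Cantelli lemma along a geometric sequence of times.

    A coordinate of a series is controlled by each of its norms, so the properties of
    [u] that are stated in the spaces [H^g] restrict to coordinates.  The exceptional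
    paths are first replaced by zero, which makes every path continuous and hence the
    scalar process jointly measurable. *)

(** * Expectation of square integrable variables *)

(** Ring identities between random variables hold outcome by outcome. *)
Ltac fring := apply/funext => ?; rewrite ?(exprfctE, scalrfctE, fctE) /GRing.scale /=; ring.

Section mean.
Context d (T : measurableType d) (R : realType) (P : probability T R).
Implicit Types X Y : T -> R.
Local Notation L1 := (Lfun P 1%E).
Local Notation L2 := (Lfun P 2%:E).

Definition mean X : R := fine 'E_P[X].

Lemma meanE X : X \in L1 -> (mean X)%:E = 'E_P[X]%E.
Proof. by move=> X1; rewrite fineK// expectation_fin_num. Qed.

Lemma mean_cst (c : R) : mean (cst c) = c.
Proof. by rewrite /mean expectation_cst. Qed.

Lemma meanD X Y : X \in L1 -> Y \in L1 -> mean (X + Y) = mean X + mean Y.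
Proof.
by move=> X1 Y1; rewrite /mean expectationD// fineD// expectation_fin_num.
Qed.

Lemma L1Z (c : R) X : X \in L1 -> c *: X \in L1.
Proof.
move=> X1; have := Lfun_scale c (lexx _) X1.
by rewrite (_ : c \o* X = c *: X)//; apply/funext => w /=; rewrite mulrC.
Qed.

Lemma meanZ (c : R) X : X \in L1 -> mean (c *: X) = c * mean X.
Proof.
move=> X1; rewrite /mean (_ : c *: X = c \o* X); last first.
  by apply/funext => w /=; rewrite mulrC.
by rewrite expectationZl// fineM// expectation_fin_num.
Qed.

Lemma meanN X : X \in L1 -> mean (- X) = - mean X.
Proof. by move=> X1; rewrite -scaleN1r meanZ// mulN1r. Qed.

Lemma meanB X Y : X \in L1 -> Y \in L1 -> mean (X - Y) = mean X - mean Y.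
Proof. by move=> X1 Y1; rewrite meanD ?rpredN// meanN. Qed.

Lemma mean_ge0 X : (forall w, 0 <= X w) -> 0 <= mean X.
Proof. by move=> X0; apply: fine_ge0; apply: expectation_ge0. Qed.

Lemma mean_le X Y : X \in L1 -> Y \in L1 -> (forall w, X w <= Y w) ->
  mean X <= mean Y.
Proof.
move=> X1 Y1 XY; rewrite -subr_ge0 -meanB//; apply: mean_ge0 => w.
by rewrite !fctE subr_ge0.
Qed.

Lemma mean_sum (I : Type) (s : seq I) (X : I -> T -> R) :
  (forall i, X i \in L1) ->
  mean (\sum_(i <- s) X i) = \sum_(i <- s) mean (X i).
Proof.
move=> X1; elim: s => [|i s IH].
  by rewrite !big_nil (_ : 0 = cst 0)// mean_cst.
by rewrite !big_cons meanD ?IH// rpred_sum.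
Qed.

Lemma L1_measurable X : X \in L1 -> measurable_fun setT X.
Proof. by rewrite inE => /andP[]; rewrite inE. Qed.

Lemma L2_measurable X : X \in L2 -> measurable_fun setT X.
Proof. by rewrite inE => /andP[]; rewrite inE. Qed.

Lemma L2P X : measurable_fun setT X ->
  (\int[P]_w (X w ^+ 2)%:E < +oo)%E -> X \in L2.
Proof.
move=> mX Xoo; rewrite inE; apply/andP; split; rewrite inE//=.
rewrite /finite_norm unlock poweR_lty//.
apply: le_lt_trans Xoo; rewrite le_eqVlt; apply/orP; left; apply/eqP.
by apply: eq_integral => w _ /=; rewrite powR_mulrn// -normrX ger0_norm// sqr_ge0.
Qed.

Lemma L1P X : measurable_fun setT X ->
  (\int[P]_w (`|X w|)%:E < +oo)%E -> X \in L1.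
Proof.
by move=> mX Xoo; apply/Lfun1_integrable/integrableP; split => //; exact/measurable_EFinP.
Qed.

Lemma L2M X Y : X \in L2 -> Y \in L2 -> X * Y \in L1.
Proof. by move=> X2 Y2; exact: Lfun2_mul_Lfun1. Qed.

Lemma L2_sqr X : X \in L2 -> X ^+ 2 \in L1.
Proof. by move=> X2; rewrite expr2 L2M. Qed.

Lemma L2_L1 X : X \in L2 -> X \in L1.
Proof. by apply: Lfun_subset12; rewrite fin_num_measure. Qed.

Lemma L2_cst c : cst c \in L2.
Proof. exact: Lfun_cst. Qed.

Lemma L2Z (c : R) X : X \in L2 -> c *: X \in L2.
Proof.
move=> X1; have := Lfun_scale c (ler1n _ 2) X1.
by rewrite (_ : c \o* X = c *: X)//; apply/funext => w /=; rewrite mulrC.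
Qed.

Lemma L2D X Y : X \in L2 -> Y \in L2 -> X + Y \in L2.
Proof.
move=> X2 Y2; apply: L2P; first by apply: measurable_funD; exact: L2_measurable.
have : 2 *: (X ^+ 2 + Y ^+ 2) \in L1 by rewrite L1Z// rpredD ?L2_sqr.
move=> /Lfun1_integrable/integrableP[mS]; apply: le_lt_trans.
have mXY : measurable_fun setT (X + Y).
  by apply: measurable_funD; exact: L2_measurable.
apply: ge0_le_integral => //.
- by move=> w _; rewrite lee_fin sqr_ge0.
- by apply/measurable_EFinP; exact: measurable_funX.
- by apply: measurableT_comp.
- move=> w _; rewrite lee_fin; apply: le_trans (ler_norm _).
  have -> : (X + Y) w = X w + Y w by [].
  have -> : (2 *: (X ^+ 2 + Y ^+ 2)) w = 2 * (X w ^+ 2 + Y w ^+ 2) by [].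
  rewrite -subr_ge0 (_ : _ - _ = (X w - Y w) ^+ 2) ?sqr_ge0//; ring.
Qed.

Lemma L2B X Y : X \in L2 -> Y \in L2 -> X - Y \in L2.
Proof. by move=> X2 Y2; rewrite -scaleN1r L2D// L2Z. Qed.

Lemma L2_sum (I : Type) (s : seq I) (X : I -> T -> R) :
  (forall i, X i \in L2) -> \sum_(i <- s) X i \in L2.
Proof.
move=> X2; elim: s => [|i s IH]; first by rewrite big_nil; exact: (L2_cst 0).
by rewrite big_cons L2D.
Qed.

Lemma integral_sqr X : X \in L2 ->
  (\int[P]_w (X w ^+ 2)%:E = (mean (X ^+ 2))%:E)%E.
Proof. by move=> X2; rewrite meanE ?L2_sqr// unlock. Qed.

Lemma mean_sqr_ge0 X : 0 <= mean (X ^+ 2).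
Proof. by apply: mean_ge0 => w; rewrite exprfctE sqr_ge0. Qed.

Lemma mean_sqrZ c X : X \in L2 -> mean ((c *: X) ^+ 2) = c ^+ 2 * mean (X ^+ 2).
Proof. move=> X2; rewrite (_ : (c *: X) ^+ 2 = c ^+ 2 *: X ^+ 2); last by fring.
by rewrite meanZ// L2_sqr. Qed.

Lemma mean_sqrD X Y : X \in L2 -> Y \in L2 ->
  mean ((X + Y) ^+ 2) = mean (X ^+ 2) + 2 * mean (X * Y) + mean (Y ^+ 2).
Proof.
move=> X2 Y2.
rewrite (_ : (X + Y) ^+ 2 = X ^+ 2 + 2 *: (X * Y) + Y ^+ 2); last by fring.
by rewrite meanD ?rpredD ?L1Z ?L2M ?L2_sqr// meanD ?L1Z ?L2M ?L2_sqr// meanZ ?L2M.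
Qed.

Lemma mean_sqrD_le X Y : X \in L2 -> Y \in L2 ->
  mean ((X + Y) ^+ 2) <= 2 * mean (X ^+ 2) + 2 * mean (Y ^+ 2).
Proof.
move=> X2 Y2; rewrite mean_sqrD//.
have := mean_sqr_ge0 (X - Y).
rewrite (_ : (X - Y) ^+ 2 = X ^+ 2 + (-2) *: (X * Y) + Y ^+ 2); last by fring.
rewrite meanD ?rpredD ?L1Z ?L2M ?L2_sqr// meanD ?L1Z ?L2M ?L2_sqr// meanZ ?L2M//.
lra.
Qed.

Lemma mean_sqrB_le X Y : X \in L2 -> Y \in L2 ->
  mean ((X - Y) ^+ 2) <= 2 * mean (X ^+ 2) + 2 * mean (Y ^+ 2).
Proof.
move=> X2 Y2; rewrite -[- Y]scaleN1r (le_trans (mean_sqrD_le _ _)) ?L2Z//.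
by rewrite mean_sqrZ// sqrrN expr1n mul1r.
Qed.

End mean.
Arguments mean {d T R} P X.

(** * Products of independent variables *)

Section independence.
Context d (T : measurableType d) (R : realType) (P : probability T R).
Implicit Types X Y : T -> R.
Local Notation L1 := (Lfun P 1%E).
Local Notation L2 := (Lfun P 2%:E).

Definition independent X Y := forall A B : set R, measurable A -> measurable B ->
  P (X @^-1` A `&` Y @^-1` B) = (P (X @^-1` A) * P (Y @^-1` B))%E.

Lemma independent_comp X Y (f g : R -> R) : measurable_fun setT f ->
  measurable_fun setT g -> independent X Y -> independent (f \o X) (g \o Y).
Proof.
move=> mf mg XY A B mA mB; rewrite (comp_preimage A X f) (comp_preimage B Y g); apply: XY.
- by rewrite -[X in measurable X]setTI; exact: mf.
- by rewrite -[X in measurable X]setTI; exact: mg.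
Qed.

Section joint_law.
Variables X Y : {mfun T >-> R}.
Hypothesis XY : independent X Y.
Let mXY : measurable_fun setT (fun w => (X w, Y w)).
Proof. exact: measurable_fun_pair. Qed.

(** Rectangles determine a finite measure on the plane, and on rectangles this is
    the product rule that defines independence. *)
Lemma joint_law (A : set (R * R)) : measurable A ->
  pushforward P (fun w => (X w, Y w)) A =
  (distribution P X \x distribution P Y)%E A.
Proof.
pose Zm := isMeasurableFun.Build _ _ _ _ _ mXY.
pose Z : {mfun T >-> (R * R)%type} := HB.pack (fun w => (X w, Y w)) Zm.
move=> mA; apply/esym.
exact: (@product_measure_unique _ _ _ _ _ (distribution P X) (distribution P Y)
  (distribution P Z)).
Qed.

Lemma ge0_independent_integral (f : R * R -> \bar R) :
  measurable_fun setT f -> (forall z, 0 <= f z)%E ->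
  (\int[P]_w f (X w, Y w) =
   \int[distribution P X]_x \int[distribution P Y]_y f (x, y))%E.
Proof.
pose Zm := isMeasurableFun.Build _ _ _ _ _ mXY.
pose Z : {mfun T >-> (R * R)%type} := HB.pack (fun w => (X w, Y w)) Zm.
move=> mf f0; rewrite -(fubini_tonelli1 f mf)//.
rewrite -[LHS](@ge0_integral_distribution _ _ _ _ _ P Z f mf f0).
by apply: eq_measure_integral => A mA _; exact: joint_law.
Qed.

Lemma independent_integral (f : R * R -> \bar R) :
  measurable_fun setT f -> P.-integrable setT (fun w => f (X w, Y w)) ->
  (\int[P]_w f (X w, Y w) =
   \int[distribution P X]_x \int[distribution P Y]_y f (x, y))%E.
Proof.
pose Zm := isMeasurableFun.Build _ _ _ _ _ mXY.
pose Z : {mfun T >-> (R * R)%type} := HB.pack (fun w => (X w, Y w)) Zm.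
move=> mf intf.
rewrite -[LHS](@integral_distribution _ _ _ _ _ P Z f mf intf).
rewrite (eq_measure_integral (distribution P X \x distribution P Y)%E); last first.
  by move=> A mA _; exact: joint_law.
rewrite -integral12_prod_meas1//.
apply/integrable12ltyP => //.
have mf' : measurable_fun setT (abse \o f) by exact: measurableT_comp.
rewrite -[ltLHS](@ge0_independent_integral (abse \o f) mf' (fun=> abse_ge0 _)).
by have /integrableP[] := intf.
Qed.

End joint_law.

(** By Tonelli, the mean of [|X Y|] is the product of the means of [|X|] and [|Y|]. *)
Lemma independent_L1M X Y : X \in L1 -> Y \in L1 -> independent X Y ->
  X * Y \in L1.
Proof.
move=> X1 Y1 XY; have mX := L1_measurable X1; have mY := L1_measurable Y1.
pose X' : {mfun T >-> R} := HB.pack X (isMeasurableFun.Build _ _ _ _ X mX).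
pose Y' : {mfun T >-> R} := HB.pack Y (isMeasurableFun.Build _ _ _ _ Y mY).
apply: L1P; first exact: measurable_funM.
have mf : measurable_fun setT (fun z : R * R => (`|z.1 * z.2|)%:E).
  by apply/measurable_EFinP; apply: measurableT_comp => //; exact: measurable_funM.
have -> : (\int[P]_w (`|(X * Y) w|)%:E = \int[P]_w (`|X' w * Y' w|)%:E)%E by [].
rewrite (@ge0_independent_integral X' Y' XY (fun z => (`|z.1 * z.2|)%:E))//.
have absX (Z : {mfun T >-> R}) :
    (\int[distribution P Z]_y (`|y|)%:E = \int[P]_w (`|Z w|)%:E)%E.
  rewrite (@ge0_integral_distribution _ _ _ _ _ P Z (fun y => (`|y|)%:E))//.
  by apply/measurable_EFinP; exact: normr_measurable.
have absL (Z : {mfun T >-> R}) : (Z : T -> R) \in L1 ->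
    (\int[distribution P Z]_y (`|y|)%:E \is a fin_num)%E.
  move=> /Lfun1_integrable/integrableP[_ Zoo].
  by rewrite absX ge0_fin_numE// integral_ge0.
under eq_integral => x _.
  under eq_integral do rewrite /= normrM EFinM.
  rewrite ge0_integralZl_EFin//; last by apply/measurable_EFinP; exact: normr_measurable.
  rewrite -(fineK (absL Y' Y1)) muleC.
  over.
rewrite ge0_integralZl_EFin ?fine_ge0 ?integral_ge0//; last first.
  by apply/measurable_EFinP; exact: normr_measurable.
by rewrite -(fineK (absL X' X1)) -EFinM ltry.
Qed.

Lemma independent_meanM X Y : X \in L1 -> Y \in L1 -> independent X Y ->
  mean P (X * Y) = mean P X * mean P Y.
Proof.
move=> X1 Y1 XY; have mX := L1_measurable X1; have mY := L1_measurable Y1.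
pose X' : {mfun T >-> R} := HB.pack X (isMeasurableFun.Build _ _ _ _ X mX).
pose Y' : {mfun T >-> R} := HB.pack Y (isMeasurableFun.Build _ _ _ _ Y mY).
have XY1 := independent_L1M X1 Y1 XY.
have law (Z : {mfun T >-> R}) : (Z : T -> R) \in L1 ->
    (\int[distribution P Z]_y y%:E = (mean P Z)%:E)%E.
  move=> Z1; rewrite meanE// (@integral_distribution _ _ _ _ _ P Z EFin)//.
    by rewrite unlock.
  exact/Lfun1_integrable.
have intd (Z : {mfun T >-> R}) : (Z : T -> R) \in L1 ->
    (distribution P Z).-integrable setT EFin.
  move=> /Lfun1_integrable/integrableP[_ Zoo]; apply/integrableP; split => //.
  rewrite (@ge0_integral_distribution _ _ _ _ _ P Z (fun y => (`|y%:E|)%E))//.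
  exact: measurableT_comp.
apply: EFin_inj; rewrite meanE// unlock EFinM.
have mf : measurable_fun setT (fun z : R * R => (z.1 * z.2)%:E).
  by apply/measurable_EFinP; exact: measurable_funM.
rewrite (@independent_integral X' Y' XY (fun z => (z.1 * z.2)%:E))//; last first.
  exact/Lfun1_integrable.
under eq_integral => x _.
  under eq_integral do rewrite /= EFinM.
  rewrite integralZl//; last exact: intd.
  rewrite law// muleC.
  over.
rewrite integralZl//; last exact: intd.
by rewrite law// muleC.
Qed.

Lemma independent_L2M X Y : X \in L2 -> Y \in L2 -> independent X Y ->
  X * Y \in L2 /\ mean P ((X * Y) ^+ 2) = mean P (X ^+ 2) * mean P (Y ^+ 2).
Proof.
move=> X2 Y2 XY; have msq : measurable_fun setT (fun x : R => x ^+ 2).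
  exact: measurable_funX.
have XY2 : independent (X ^+ 2) (Y ^+ 2) := independent_comp msq msq XY.
have sqE : (X * Y) ^+ 2 = X ^+ 2 * Y ^+ 2 by fring.
have XY1 : (X * Y) ^+ 2 \in L1 by rewrite sqE independent_L1M// L2_sqr.
split; last by rewrite sqE independent_meanM// L2_sqr.
have mXY : measurable_fun setT (X * Y).
  by apply: measurable_funM; [exact: L2_measurable X2|exact: L2_measurable Y2].
apply: L2P => //.
move: (XY1) => /Lfun1_integrable/integrableP[_]; apply: le_lt_trans.
apply: ge0_le_integral => //.
- by move=> w _; rewrite lee_fin sqr_ge0.
- apply/measurable_EFinP; exact: measurable_funX.
- apply/measurable_EFinP; apply: measurableT_comp => //; exact: L1_measurable XY1.
- by move=> w _; rewrite /= lee_fin ler_norm.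
Qed.

End independence.

(** * Gaussian moments *)

Section normal_moments.
Context (R : realType).
Local Notation mu := (@lebesgue_measure R).
Implicit Types (h c : R).

(** The Radon-Nikodym derivative of the Gaussian measure is its density, almost
    everywhere, because both have the same integrals over measurable sets. *)
Lemma ge0_integral_normal (m s : R) (f : R -> R) :
  measurable_fun setT f -> (forall x, 0 <= f x) ->
  (\int[normal_prob m s]_x (f x)%:E =
   \int[mu]_x (f x * normal_pdf m s x)%:E)%E.
Proof.
move=> mf f0.
pose nu : {finite_measure set (measurableTypeR R) -> \bar R} := normal_prob m s.
have numu : nu `<< mu by exact: normal_prob_dominates.
rewrite -[LHS](Radon_Nikodym_SigmaFinite.change_of_variables numu)//; last 1 first.
- exact/measurable_EFinP.
have intg := Radon_Nikodym_SigmaFinite.f_integrable numu.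
apply: ae_eq_integral => //.
- apply: emeasurable_funM; first exact/measurable_EFinP.
  exact: (measurable_int mu).
- by apply/measurable_EFinP/measurable_funM => //; exact: measurable_normal_pdf.
have : ae_eq mu setT (Radon_Nikodym_SigmaFinite.f nu mu)
    (fun x => (normal_pdf m s x)%:E).
  apply: integral_ae_eq => //.
  - by apply/measurable_EFinP; exact: measurable_normal_pdf.
  - by move=> A _ mA; rewrite -Radon_Nikodym_SigmaFinite.f_integral.
by apply: filterS => x h Ix; rewrite h.
Qed.

(** Multiplying the centred density by [expR (c * x)] moves its centre to
    [c * s ^+ 2] (complete the square), up to the constant on the right. *)
Lemma normal_mgf (s c : R) : s != 0 ->
  (\int[normal_prob 0 s]_x (expR (c * x))%:E = (expR (c ^+ 2 * s ^+ 2 / 2))%:E)%E.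
Proof.
move=> s0; rewrite ge0_integral_normal ?expR_ge0//; last first.
  by apply: measurableT_comp => //; exact: measurable_funM.
under eq_integral => x _.
  have -> : expR (c * x) * normal_pdf 0 s x =
      expR (c ^+ 2 * s ^+ 2 / 2) * normal_pdf (c * s ^+ 2) s x.
    rewrite !normal_pdfE//= /normal_fun mulrCA [RHS]mulrCA -!expRD.
    by congr (_ * expR _); field.
  rewrite EFinM.
  over.
rewrite integralZl//=; last exact: integrable_normal_pdf.
by rewrite integral_normal_pdf mule1.
Qed.

(** The derivative of order [n] in [c] of [expR (c * x)]. *)
Definition mexp (n : nat) (c x : R) : R := x ^+ n * expR (c * x).

Lemma measurable_mexp n c : measurable_fun setT (mexp n c).
Proof.
apply: measurable_funM; first exact: measurable_funX.
by apply: measurableT_comp => //; exact: measurable_funM.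
Qed.

(** One bound for all [c] in a bounded interval: it dominates the difference
    quotients of [mexp n.-1] when differentiating under the integral. It rests on
    [`|x| <= expR `|x|]. *)
Lemma mexp_le n (c a x : R) : `|c| <= a ->
  `|mexp n c x| <= expR ((n%:R + a) * x) + expR (- (n%:R + a) * x).
Proof.
move=> ca; have a0 : 0 <= a by rewrite (le_trans _ ca).
apply: (@le_trans _ _ (expR ((n%:R + a) * `|x|))).
  rewrite normrM normrX (ger0_norm (expR_ge0 _)) mulrDl expRD.
  apply: ler_pM; rewrite ?exprn_ge0 ?expR_ge0//.
    rewrite expRM_natl lerXn2r// ?nnegrE ?expR_ge0//.
    by apply: le_trans (expR_ge1Dx _); rewrite lerDr.
  rewrite ler_expR (le_trans (ler_norm _))// normrM ler_wpM2r//.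
case: (leP 0 x) => x0; first by rewrite ger0_norm// lerDl expR_ge0.
by rewrite ltr0_norm// mulrN -mulNr lerDr expR_ge0.
Qed.

Variable s : R.
Hypothesis s0 : s != 0.
Local Notation N := (normal_prob 0 s).

Lemma integrable_exp c : N.-integrable setT (fun x => (expR (c * x))%:E).
Proof.
apply/integrableP; split.
  apply/measurable_EFinP; apply: measurableT_comp => //; exact: measurable_funM.
under eq_integral do rewrite /= ger0_norm ?expR_ge0//.
by rewrite normal_mgf// ltry.
Qed.

Lemma integrable_dominant k :
  N.-integrable setT (fun x => (expR (k * x) + expR (- k * x))%:E).
Proof.
have := integrableD _ (integrable_exp k) (integrable_exp (- k)).
exact.
Qed.

Lemma integrable_mexp n c : N.-integrable setT (EFin \o mexp n c).
Proof.
apply: le_integrable (integrable_dominant (n%:R + `|c|)) => //.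
  by apply/measurable_EFinP; exact: measurable_mexp.
move=> x _; rewrite /= lee_fin [leRHS]ger0_norm ?addr_ge0 ?expR_ge0//.
exact: mexp_le.
Qed.

Lemma derive1_mexp n c x : partial1of2 (mexp n) c x = mexp n.+1 c x.
Proof.
rewrite /partial1of2 /mexp derive1E.
have da : is_derive c 1 ( *%R ^~ x : R -> R) x.
  rewrite (_ : *%R ^~ x = *%R x); last by apply/funext => y; rewrite mulrC.
  by apply: is_derive_eq; rewrite /GRing.scale/= mulr1.
have := is_deriveZ (x ^+ n)
  (@is_derive1_comp _ expR ( *%R ^~ x) c _ _ (is_derive_expR (c * x)) da) => d.
rewrite (@derive_val _ _ _ _ _ _ _ d) /GRing.scale /= exprSr; ring.
Qed.

Lemma derivable_mexp n c x : derivable (mexp n ^~ x) c 1.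
Proof.
have da : is_derive c 1 ( *%R ^~ x : R -> R) x.
  rewrite (_ : *%R ^~ x = *%R x); last by apply/funext => y; rewrite mulrC.
  by apply: is_derive_eq; rewrite /GRing.scale/= mulr1.
have := is_deriveZ (x ^+ n)
  (@is_derive1_comp _ expR ( *%R ^~ x) c _ _ (is_derive_expR (c * x)) da) => d.
exact: (@ex_derive _ _ _ _ _ _ _ d).
Qed.

(** The derivative of order [n] of the moment generating function; at [c = 0], the
    moment of order [n]. *)
Definition moment n c : R := (\int[N]_x mexp n c x)%R.

Lemma is_derive_moment n (a : R) : is_derive a 1 (moment n) (moment n.+1 a).
Proof.
pose k := n.+1%:R + (`|a| + 1).
have Iabs x : `]a - 1, a + 1[%classic x -> `|x| <= `|a| + 1.
  rewrite /= in_itv/= => /andP[ax xa]; have -> : x = a + (x - a) by ring.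
  rewrite (le_trans (ler_normD _ _))// lerD2l ler_norml; apply/andP; split; lra.
have Ia : `]a - 1, a + 1[%classic a by rewrite /= in_itv/=; apply/andP; split; lra.
have lim : h^-1 *: (moment n (h + a) - moment n a) @[h --> 0^'] --> moment n.+1 a.
  have -> : moment n.+1 a = (\int[N]_x partial1of2 (mexp n) a x)%R.
    by apply: eq_Rintegral => x _; rewrite derive1_mexp.
  apply: (@cvg_differentiation_under_integral _ _ _ N (mexp n) setT measurableT
    a (a - 1) (a + 1) Ia _ _ (fun x => expR (k * x) + expR (- k * x))).
  - by move=> x _; exact: integrable_mexp.
  - by move=> x y _ _; exact: derivable_mexp.
  - by move=> y; rewrite addr_ge0 ?expR_ge0.
  - exact: integrable_dominant.
  - by move=> x y Ix _; rewrite derive1_mexp; apply: mexp_le; exact: Iabs.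
apply: DeriveDef.
  rewrite /derivable; apply/cvg_ex; exists (moment n.+1 a).
  by under eq_fun do rewrite scaler1.
rewrite /derive; apply: (cvg_lim (@Rhausdorff R)).
by under eq_fun do rewrite scaler1.
Qed.

Lemma moment0 c : moment 0 c = expR (c ^+ 2 * s ^+ 2 / 2).
Proof.
rewrite /moment /Rintegral -[RHS]/(fine (expR (c ^+ 2 * s ^+ 2 / 2))%:E).
rewrite -normal_mgf//; congr fine; apply: eq_integral => x _.
by rewrite /mexp expr0 mul1r.
Qed.

Lemma is_derive_gauss c :
  is_derive c 1 (fun c => expR (c ^+ 2 * s ^+ 2 / 2)) (c * s ^+ 2 * expR (c ^+ 2 * s ^+ 2 / 2)).
Proof.
have d : is_derive c 1 (fun c : R => c ^+ 2 * s ^+ 2 / 2) (c * s ^+ 2).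
  by apply: is_derive_eq; rewrite /GRing.scale/= ?mulr1; field.
have := @is_derive1_comp _ expR (fun c => c ^+ 2 * s ^+ 2 / 2) c _ _
  (is_derive_expR (c ^+ 2 * s ^+ 2 / 2)) d => {}d.
by apply: is_derive_eq; rewrite mulrC.
Qed.

Lemma moment1 c : moment 1 c = c * s ^+ 2 * expR (c ^+ 2 * s ^+ 2 / 2).
Proof.
have := is_derive_moment 0 c; rewrite (funext moment0) => d1.
by rewrite -(@derive_val _ _ _ _ _ _ _ d1) (@derive_val _ _ _ _ _ _ _ (is_derive_gauss c)).
Qed.

Lemma moment2 : moment 2 0 = s ^+ 2.
Proof.
have := is_derive_moment 1 0; rewrite (funext moment1) => d1.
rewrite -(@derive_val _ _ _ _ _ _ _ d1).
have d2 : is_derive (0 : R) 1 (fun c : R => c * s ^+ 2) (s ^+ 2).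
  by apply: is_derive_eq; rewrite /GRing.scale/= ?mulr1; field.
have := is_deriveM d2 (is_derive_gauss 0) => d.
rewrite (@derive_val _ _ _ _ _ _ _ d) /GRing.scale /=.
by rewrite expr0n/= ?mul0r ?expR0 ?mul0r ?add0r ?mul1r.
Qed.

End normal_moments.

Section normal_variable.
Context d (T : measurableType d) (R : realType) (P : probability T R).
Variables (D : T -> R) (h : R).
Hypotheses (mD : measurable_fun setT D) (h0 : 0 < h).
Hypothesis lawD : forall B : set R, measurable B ->
  P (D @^-1` B) = normal_prob 0 (Num.sqrt h) B.
Local Notation L1 := (Lfun P 1%E).
Local Notation L2 := (Lfun P 2%:E).
Local Notation N := (normal_prob 0 (Num.sqrt h)).

Let s0 : Num.sqrt h != 0. Proof. by rewrite gt_eqF// sqrtr_gt0. Qed.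
Let sqrs : Num.sqrt h ^+ 2 = h. Proof. by rewrite sqr_sqrtr// ltW. Qed.
(** Gaussian measures live on [measurableTypeR R], which has another display than [R]. *)
Let D' : {mfun T >-> measurableTypeR R} :=
  HB.pack D (isMeasurableFun.Build _ _ _ _ (D : T -> measurableTypeR R) mD).

Lemma mean_normal (f : R -> R) : measurable_fun setT f ->
  N.-integrable setT (EFin \o f) ->
  f \o D \in L1 /\ mean P (f \o D) = (\int[N]_x f x)%R.
Proof.
move=> mf intf.
have lawE (g : R -> \bar R) :
    (\int[distribution P D']_x g x = \int[N]_x g x)%E.
  by apply: eq_measure_integral => A mA _; exact: lawD.
have fD1 : f \o D \in L1.
  apply: L1P; first exact: measurableT_comp.
  have := @ge0_integral_distribution _ _ _ _ _ P D' (fun y => (`|f y|)%:E).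
  rewrite lawE /comp => <- //; last first.
    by apply/measurable_EFinP; exact: measurableT_comp.
  by have /integrableP[] := intf.
split => //; rewrite /mean unlock /Rintegral; congr fine.
rewrite -lawE (@integral_distribution _ _ _ _ _ P D' (EFin \o f))//.
  exact/measurable_EFinP.
exact/Lfun1_integrable.
Qed.

Let mean_mexp n c : mexp n c \o D \in L1 /\
  mean P (mexp n c \o D) = moment (Num.sqrt h) n c.
Proof.
by apply: mean_normal; [exact: measurable_mexp|exact: integrable_mexp].
Qed.

Lemma normal_mean : D \in L1 /\ mean P D = 0.
Proof.
have [] := mean_mexp 1 0; rewrite moment1// !mul0r.
rewrite (_ : mexp 1 0 \o D = D)//.
by apply/funext => w /=; rewrite /mexp expr1 mul0r expR0 mulr1.
Qed.

Lemma normal_sqr : D \in L2 /\ mean P (D ^+ 2) = h.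
Proof.
have [] := mean_mexp 2 0; rewrite moment2// sqrs.
have -> : mexp 2 0 \o D = D ^+ 2.
  by apply/funext => w /=; rewrite /mexp mul0r expR0 mulr1.
move=> D1 mD2; split => //; apply: L2P => //.
by rewrite -[ltLHS]/(\int[P]_w ((D ^+ 2) w)%:E)%E; move: (expectation_fin_num D1);
  rewrite unlock ge0_fin_numE// integral_ge0// => w _; rewrite lee_fin sqr_ge0.
Qed.

(** The exponential of [D] divided by its mean. *)
Definition wick (w : T) : R := expR (D w - h / 2).

Let wickE c : (fun w => wick w ^+ c) =
  expR (- (c%:R * h / 2)) *: (mexp 0 c%:R \o D).
Proof.
apply/funext => w; rewrite scalrfctE /GRing.scale /= /mexp expr0 mul1r.
by rewrite -expRM_natl -expRD; congr expR; field.
Qed.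

Lemma wick_L2 : wick \in L2 /\ mean P (wick ^+ 2) = expR h.
Proof.
have [m1 m2] := mean_mexp 0 2.
have wE : wick ^+ 2 = expR (- h) *: (mexp 0 2 \o D).
  by have := wickE 2; rewrite (_ : 2 * h / 2 = h) //; field.
have w1 : wick ^+ 2 \in L1 by rewrite wE L1Z.
split.
  apply: L2P.
    by apply: measurableT_comp => //; exact: measurable_funB.
  by rewrite -[ltLHS]/(\int[P]_w ((wick ^+ 2) w)%:E)%E; move: (expectation_fin_num w1);
    rewrite unlock ge0_fin_numE// integral_ge0// => w _; rewrite lee_fin sqr_ge0.
rewrite wE meanZ// m2 moment0// sqrs -expRD; congr expR; by field.
Qed.

Lemma mean_wick : mean P wick = 1.
Proof.
have [m1 m2] := mean_mexp 0 1.
have -> : wick = expR (- (h / 2)) *: (mexp 0 1 \o D).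
  by have := wickE 1; rewrite mul1r => <-.
rewrite meanZ// m2 moment0// sqrs expr1n mul1r -expRD addNr expR0//.
Qed.

Lemma mean_normal_wick : mean P (D * wick) = h.
Proof.
have [m1 m2] := mean_mexp 1 1.
have -> : D * wick = expR (- (h / 2)) *: (mexp 1 1 \o D).
  apply/funext => w.
  rewrite -[LHS]/(D w * expR (D w - h / 2)) -[RHS]/(expR (- (h / 2)) * mexp 1 1 (D w)).
  by rewrite /mexp expr1 mul1r mulrCA -expRD addrC.
rewrite meanZ// m2 moment1// sqrs expr1n !mul1r mulrCA -expRD addNr expR0 mulr1//.
Qed.

(** The quadratic and cross moments combine so that the terms of order 0 and 1
    in [h] cancel: [D] is the first order part of the exponential up to an error of
    order [h ^+ 2] in mean square. *)
Lemma wick_linear :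
  mean P ((wick - cst 1 - D) ^+ 2) = expR h - 1 - h.
Proof.
have [w2 mw2] := wick_L2; have [D2 mD2] := normal_sqr; have [_ mD1] := normal_mean.
have c1 : (cst 1 : T -> R) \in L2 := L2_cst P 1.
have -> : (wick - cst 1 - D) ^+ 2 =
    wick ^+ 2 + D ^+ 2 + cst 1 + (-2) *: wick + (-2) *: (D * wick) + 2 *: D.
  by fring.
rewrite !meanD ?rpredD ?L1Z ?L2M ?L2_sqr ?(L2_L1 c1) ?(L2_L1 w2) ?(L2_L1 D2)//.
rewrite !meanZ ?L2M ?L2_L1// mw2 mD2 mD1 mean_wick mean_normal_wick.
rewrite (mean_cst P 1); ring.
Qed.

End normal_variable.

(** * Brownian increments *)

Section measurable_wrt.
Context d (T : measurableType d) (R : realType).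
Implicit Types (G : set (set T)) (X Y : T -> R).

(** Measurability is expressed over the type that carries the sigma-algebra [G], so
    that the closure properties of measurable functions apply. *)
Definition measurable_wrt G X :=
  measurable_fun [set: g_sigma_algebraType G] (X : g_sigma_algebraType G -> R).

Lemma measurable_wrtP G X : sigma_algebra setT G ->
  measurable_wrt G X <-> forall B : set R, measurable B -> G (X @^-1` B).
Proof.
move=> sG; have GE : <<s G >> = G by exact: sigma_algebra_id.
split=> [mX B mB|XG _ B mB].
  by have := mX measurableT B mB; rewrite setTI /measurable/= GE.
by rewrite setTI /measurable/= GE; exact: XG.
Qed.

Lemma measurable_wrt_sub G G' X : sigma_algebra setT G -> sigma_algebra setT G' ->
  G `<=` G' -> measurable_wrt G X -> measurable_wrt G' X.
Proof.
move=> sG sG' GG' /(measurable_wrtP _ sG) mX; apply/(measurable_wrtP _ sG') => B mB.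
by apply: GG'; exact: mX.
Qed.

Lemma measurable_wrt_measurable G X : sigma_algebra setT G ->
  G `<=` measurable -> measurable_wrt G X -> measurable_fun setT X.
Proof.
move=> sG Gm /(measurable_wrtP _ sG) mX _ B mB.
by rewrite setTI; apply: Gm; exact: mX.
Qed.

End measurable_wrt.

Section brownian.
Context {R : realType} {d : measure_display} {Om : measurableType d}.
Variables (P : probability Om R) (F : R -> set (set Om)) (W : R -> Om -> R).
Hypotheses (hF : usual_conditions P F) (hW : brownian_motion P F W).
Local Notation L1 := (Lfun P 1%E).
Local Notation L2 := (Lfun P 2%:E).
Implicit Types (X Y v : Om -> R) (s t a b : R).

Lemma filtration_sigma t : 0 <= t -> sigma_algebra setT (F t).
Proof. by case: hF => h _ _ _ t0; have [] := h t t0. Qed.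

Lemma filtration_measurable t : 0 <= t -> F t `<=` measurable.
Proof. by case: hF => h _ _ _ t0; have [] := h t t0. Qed.

Lemma filtration_le s t : 0 <= s -> s <= t -> F s `<=` F t.
Proof. by case: hF => _ + _ _ => /[apply] /[apply]. Qed.

Lemma measurable_wrt_le s t X : 0 <= s -> s <= t ->
  measurable_wrt (F s) X -> measurable_wrt (F t) X.
Proof.
move=> s0 st; have t0 := le_trans s0 st.
by apply: measurable_wrt_sub;
  [exact: filtration_sigma|exact: filtration_sigma|exact: filtration_le].
Qed.

Definition L2_at t X := measurable_wrt (F t) X /\ X \in L2.

Lemma L2_at_cst t c : L2_at t (cst c).
Proof. by split; [exact: measurable_cst|exact: L2_cst]. Qed.

Lemma L2_atD t X Y : L2_at t X -> L2_at t Y -> L2_at t (X + Y).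
Proof. by move=> [mX X2] [mY Y2]; split; [exact: measurable_funD|exact: L2D]. Qed.

Lemma L2_atZ t c X : L2_at t X -> L2_at t (c *: X).
Proof.
move=> [mX X2]; split; last exact: L2Z.
by apply: measurable_funM => //; exact: measurable_cst.
Qed.

Lemma L2_atB t X Y : L2_at t X -> L2_at t Y -> L2_at t (X - Y).
Proof. by move=> X2 Y2; rewrite -scaleN1r; apply: L2_atD => //; exact: L2_atZ. Qed.

Lemma L2_at_le s t X : 0 <= s -> s <= t -> L2_at s X -> L2_at t X.
Proof. by move=> s0 st [mX X2]; split => //; exact: measurable_wrt_le mX. Qed.

Local Notation dW s t := (W t - W s).

Lemma brownian_measurable_wrt t : 0 <= t -> measurable_wrt (F t) (W t).
Proof.
move=> t0; apply/measurable_wrtP; first exact: filtration_sigma.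
by case: hW => _ _ h _ _ B mB; exact: h.
Qed.

Lemma increment_measurable_wrt s t : 0 <= s -> s <= t ->
  measurable_wrt (F t) (dW s t).
Proof.
move=> s0 st; have t0 := le_trans s0 st.
apply: measurable_funB; first exact: brownian_measurable_wrt.
by apply: measurable_wrt_le st _ => //; exact: brownian_measurable_wrt.
Qed.

Lemma increment_measurable s t : 0 <= s -> s <= t ->
  measurable_fun setT (dW s t).
Proof.
move=> s0 st; have t0 := le_trans s0 st.
apply: measurable_wrt_measurable (increment_measurable_wrt s0 st).
  exact: filtration_sigma.
exact: filtration_measurable.
Qed.

Lemma increment_law s t : 0 <= s -> s < t -> forall B : set R, measurable B ->
  P (dW s t @^-1` B) = normal_prob 0 (Num.sqrt (t - s)) B.
Proof. by case: hW => _ _ _ + _ => h s0 st B mB; exact: h. Qed.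

Lemma increment_independent s t X : 0 <= s -> s < t ->
  measurable_wrt (F s) X -> independent P X (dW s t).
Proof.
case: hW => _ _ _ _ h s0 st mX A B mA mB; apply: h => //.
by move/measurable_wrtP: mX => /(_ (filtration_sigma s0)); exact.
Qed.

Lemma increment_normal s t : 0 <= s -> s <= t ->
  [/\ dW s t \in L2, mean P (dW s t) = 0 & mean P (dW s t ^+ 2) = t - s].
Proof.
move=> s0; rewrite le_eqVlt => /predU1P[<-|st].
  rewrite !subrr expr0n/= (_ : 0 = cst 0)// mean_cst; split => //; exact: L2_cst.
have mD := increment_measurable s0 (ltW st).
have h0 : 0 < t - s by rewrite subr_gt0.
have [D2 E2] := normal_sqr mD h0 (increment_law s0 st).
by have [_ E1] := normal_mean mD h0 (increment_law s0 st).
Qed.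

Lemma mul_increment_L2 s t X : 0 <= s -> s <= t -> L2_at s X ->
  L2_at t (X * dW s t) /\
  mean P ((X * dW s t) ^+ 2) = mean P (X ^+ 2) * (t - s).
Proof.
move=> s0 st Xs; have [D2 _ E2] := increment_normal s0 st.
have [X2 E] : X * dW s t \in L2 /\
    mean P ((X * dW s t) ^+ 2) = mean P (X ^+ 2) * (t - s).
  move: st; rewrite le_eqVlt => /predU1P[<-|st].
    rewrite !subrr mulr0 expr0n/= (_ : 0 = cst 0)// mean_cst mulr0.
    by split => //; exact: L2_cst.
  case: Xs => mX X2; have XD := increment_independent s0 st mX.
  by have [XD2 ->] := independent_L2M X2 D2 XD; rewrite E2.
split => //; split => //; apply: measurable_funM.
  by apply: measurable_wrt_le st _ => //; case: Xs.
exact: increment_measurable_wrt.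
Qed.

Lemma mean_mul_increment s t X : 0 <= s -> s <= t -> measurable_wrt (F s) X ->
  X \in L1 -> X * dW s t \in L1 /\ mean P (X * dW s t) = 0.
Proof.
move=> s0 st mX X1; have [D2 E1 _] := increment_normal s0 st.
move: st; rewrite le_eqVlt => /predU1P[<-|st].
  by rewrite subrr mulr0 (_ : 0 = cst 0)// mean_cst; split => //; exact/L2_L1/L2_cst.
have XD := increment_independent s0 st mX.
by rewrite independent_meanM ?independent_L1M ?(L2_L1 D2)// E1 mulr0.
Qed.

Lemma mean_mul_increment_sqr s t X : 0 <= s -> s <= t ->
  measurable_wrt (F s) X -> X \in L1 ->
  X * dW s t ^+ 2 \in L1 /\ mean P (X * dW s t ^+ 2) = mean P X * (t - s).
Proof.
move=> s0 st mX X1; have [D2 _ E2] := increment_normal s0 st.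
move: st; rewrite le_eqVlt => /predU1P[<-|st].
  rewrite !subrr expr0n/= mulr0 (_ : 0 = cst 0)// mean_cst mulr0.
  by split => //; exact/L2_L1/L2_cst.
have XD := increment_independent s0 st mX.
have XD2 : independent P X (dW s t ^+ 2).
  exact: (independent_comp (@measurable_id _ _ setT)
    (exprn_measurable (D := setT) 2) XD).
have D1 := L2_sqr D2; split; first exact: independent_L1M.
by rewrite independent_meanM// E2.
Qed.

Definition overlap a b a' b' : R := Num.max 0 (Num.min b b' - Num.max a a').

Lemma increment_split s r t : dW s t = dW s r + dW r t.
Proof. by fring. Qed.

Let covariance_le a b a' b' v v' : 0 <= a -> a <= b -> a <= a' -> a' <= b' ->
  L2_at a v -> L2_at a' v' ->
  mean P (v * dW a b * (v' * dW a' b')) = mean P (v * v') * overlap a b a' b'.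
Proof.
move=> a0 ab aa' ab' va va'; have a'0 := le_trans a0 aa'.
have va'' := L2_at_le a0 aa' va.
have vv1 : v * v' \in L1 by apply: L2M; [case: va|case: va'].
have mvv : measurable_wrt (F a') (v * v').
  by apply: measurable_funM; [case: va''|case: va'].
have before r : a <= r -> r <= a' ->
    v * dW a r * (v' * dW a' b') \in L1 /\
    mean P (v * dW a r * (v' * dW a' b')) = 0.
  move=> ar ra'; rewrite mulrA; apply: mean_mul_increment => //.
    apply: measurable_funM; last by case: va'.
    have [[m _] _] := mul_increment_L2 a0 ar va.
    by apply: measurable_wrt_le m => //; exact: le_trans ar.
  by apply: L2M; [have [[]] := mul_increment_L2 a0 ar va|case: va'].
have after b1 b2 : a' <= b1 -> b1 <= b2 ->
    v * dW a' b1 * (v' * dW a' b2) \in L1 /\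
    mean P (v * dW a' b1 * (v' * dW a' b2)) = mean P (v * v') * (b1 - a').
  move=> ab1 b12.
  have b10 := le_trans a'0 ab1.
  have [l1 e1] := mean_mul_increment_sqr a'0 ab1 mvv vv1.
  have mvd : measurable_wrt (F b1) (v * v' * dW a' b1).
    apply: measurable_funM; first exact: measurable_wrt_le mvv.
    exact: increment_measurable_wrt.
  have [l0 _] := mean_mul_increment a'0 ab1 mvv vv1.
  have [l2 e2] := mean_mul_increment b10 b12 mvd l0.
  have -> : v * dW a' b1 * (v' * dW a' b2) =
      v * v' * dW a' b1 ^+ 2 + v * v' * dW a' b1 * dW b1 b2 by fring.
  by rewrite rpredD// meanD// e1 e2 addr0.
case: (leP b a') => [ba'|a'b].
  have [_ ->] := before b ab ba'; rewrite /overlap max_l ?mulr0//.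
  by rewrite subr_le0 ge_min le_max ba' orbT.
have [l1 e1] := before a' aa' (lexx _).
rewrite (increment_split a a' b) mulrDr mulrDl.
case: (leP b b') => bb'.
  have [l2 e2] := after b b' (ltW a'b) bb'.
  rewrite meanD// e1 e2 add0r /overlap (min_l bb') (max_r aa') max_r//.
  by rewrite subr_ge0 ltW.
have [] := after b' b ab' (ltW bb').
rewrite (_ : v * dW a' b' * (v' * dW a' b) = v * dW a' b * (v' * dW a' b')); last first.
  by fring.
move=> l2 e2.
rewrite meanD// e1 e2 add0r /overlap (min_r (ltW bb')) (max_r aa') max_r//.
by rewrite subr_ge0.
Qed.

(** The increments before the later starting point are known there, and are killed
    by the mean zero of the increments after it; the increments after the earlier end
    are killed in the same way. What is left is the square of the increment over the
    common part. *)
Lemma mean_mul_increments a b a' b' v v' :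
  0 <= a -> a <= b -> 0 <= a' -> a' <= b' -> L2_at a v -> L2_at a' v' ->
  mean P (v * dW a b * (v' * dW a' b')) = mean P (v * v') * overlap a b a' b'.
Proof.
move=> a0 ab a'0 ab' va va'; case: (leP a a') => aa'; first exact: covariance_le.
have := covariance_le a'0 ab' (ltW aa') ab va' va.
by rewrite (mulrC (v' * _) (v * _)) (mulrC v' v) /overlap minC (maxC a').
Qed.

End brownian.

(** * The isometry for elementary integrands *)

Section elementary_integral.
Context {R : realType} {d : measure_display} {Om : measurableType d}.
Variables (P : probability Om R) (F : R -> set (set Om)) (W : R -> Om -> R).
Hypotheses (hF : usual_conditions P F) (hW : brownian_motion P F W).
Local Notation L1 := (Lfun P 1%E).
Local Notation L2 := (Lfun P 2%:E).
Local Notation mu := (@lebesgue_measure R).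

Variables (I : Type) (l : seq I) (a b : I -> R) (c : I -> Om -> R).
Hypotheses (a0 : forall i, 0 <= a i) (ab : forall i, a i <= b i).
Hypothesis ca : forall i, L2_at P F (a i) (c i).

(** The stochastic integral of [elem_fun] below. The intervals may overlap, so
    that a constant integrand can be subtracted from a step process without refining
    its partition. *)
Definition elem_int : Om -> R := \sum_(i <- l) c i * (W (b i) - W (a i)).

Definition elem_fun (w : Om) (r : R) : R :=
  \sum_(i <- l) c i w * \1_(`]a i, b i]) r.

Lemma measure_overlap (a1 b1 a2 b2 : R) :
  mu (`]a1, b1] `&` `]a2, b2]) = (overlap a1 b1 a2 b2)%:E.
Proof.
rewrite -set_itvI/= lebesgue_measure_itv/= /overlap.
rewrite joinEtotal meetEtotal lte_fin; case: ltP => h.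
  have h' : 0 <= Num.min b1 b2 - Num.max a1 a2 by rewrite subr_ge0 ltW.
  by rewrite (max_r h').
have h' : Num.min b1 b2 - Num.max a1 a2 <= 0 by rewrite subr_le0.
by rewrite (max_l h').
Qed.

Lemma elem_int_L2 : elem_int \in L2.
Proof.
by apply: L2_sum => i; have [[]] := mul_increment_L2 hF hW (a0 i) (ab i) (ca i).
Qed.

Lemma integral_elem_fun_sqr (D : set R) (w : Om) : measurable D ->
  (forall i, `]a i, b i] `<=` D) ->
  (\int[mu]_(r in D) (elem_fun w r ^+ 2)%:E =
   (\sum_(i <- l) \sum_(j <- l) c i w * c j w *
      overlap (a i) (b i) (a j) (b j))%:E)%E.
Proof.
move=> mD lD.
pose A i : set R := `]a i, b i]%classic.
have intA i j : mu.-integrable D (fun r => (c i w * c j w * \1_(A i `&` A j) r)%:E).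
  apply: (@integrableS _ _ _ _ setT) => //.
  have -> : (fun r => (c i w * c j w * \1_(A i `&` A j) r)%:E) =
      (fun r => (c i w * c j w)%:E * (\1_(A i `&` A j) r)%:E)%E.
    by apply/funext => r; rewrite EFinM.
  apply: integrableZl => //.
  by rewrite /A -set_itvI/=; exact: integrable_indic_itv.
have sqE r : (elem_fun w r ^+ 2)%:E =
    (\sum_(i <- l) \sum_(j <- l) (c i w * c j w * \1_(A i `&` A j) r)%:E)%E.
  rewrite expr2 /elem_fun mulr_suml -sumEFin; apply: eq_bigr => i _.
  rewrite mulr_sumr -sumEFin; apply: eq_bigr => j _.
  by rewrite indicI -/(A i) -/(A j); congr EFin; rewrite /= mulrACA.
under eq_integral do rewrite sqE.
rewrite integral_sum//; last by move=> i; exact: integrable_sum.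
rewrite -sumEFin; apply: eq_bigr => i _.
rewrite integral_sum// -sumEFin; apply: eq_bigr => j _.
under eq_integral do rewrite EFinM.
rewrite integralZl//; last first.
  apply: (@integrableS _ _ _ _ setT) => //.
  by rewrite /A -set_itvI/=; exact: integrable_indic_itv.
rewrite integral_indic//; last by apply: measurableI; exact: measurable_itv.
rewrite setIidl; last by apply: subset_trans (lD i); exact: subIsetl.
by rewrite [RHS]EFinM; congr (_ * _)%E; exact: measure_overlap.
Qed.

(** Both sides are quadratic forms in the coefficients [c i]. They agree because
    the covariance of two increments and the measure of the intersection of the two
    intervals are the same number. *)
Lemma elem_isometry (D : set R) : measurable D ->
  (forall i, `]a i, b i] `<=` D) ->
  (\int[P]_w \int[mu]_(r in D) (elem_fun w r ^+ 2)%:E =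
   (mean P (elem_int ^+ 2))%:E)%E.
Proof.
move=> mD lD.
under eq_integral do rewrite integral_elem_fun_sqr//.
have c2 i : c i \in L2 by case: (ca i).
have cd2 i : c i * (W (b i) - W (a i)) \in L2.
  by have [[]] := mul_increment_L2 hF hW (a0 i) (ab i) (ca i).
pose Q : Om -> R := \sum_(i <- l) \sum_(j <- l)
  overlap (a i) (b i) (a j) (b j) *: (c i * c j).
have sumE (J : Type) (s : seq J) (f : J -> Om -> R) w :
    (\sum_(i <- s) f i) w = \sum_(i <- s) f i w.
  by elim/big_rec2: _ => // i x y _ <-.
have Q1 : Q \in L1.
  by apply: rpred_sum => i _; apply: rpred_sum => j _; rewrite L1Z ?L2M.
transitivity (mean P Q)%:E.
  have QE w : \sum_(i <- l) \sum_(j <- l) c i w * c j w *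
      overlap (a i) (b i) (a j) (b j) = Q w; last first.
    by under eq_integral do rewrite QE; rewrite meanE// unlock.
  rewrite /Q sumE; apply: eq_bigr => i _; rewrite sumE; apply: eq_bigr => j _.
  by rewrite -[RHS]/(_ * (_ * _)) mulrC.
congr EFin; rewrite expr2 /elem_int mulr_suml /Q.
rewrite !mean_sum; last 2 first.
- by move=> i; rewrite L2M// L2_sum.
- by move=> i; apply: rpred_sum => j _; rewrite L1Z ?L2M.
apply: eq_bigr => i _; rewrite mulr_sumr !mean_sum; last 2 first.
- by move=> j; rewrite L2M.
- by move=> j; rewrite L1Z ?L2M.
apply: eq_bigr => j _; rewrite meanZ ?L2M//.
by rewrite (mean_mul_increments hF hW) 1?mulrC.
Qed.

End elementary_integral.

(** * Double integrals in the path and in time *)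

Section double_integral.
Context {R : realType} {d : measure_display} {Om : measurableType d}.
Variable P : probability Om R.
Local Notation mu := (@lebesgue_measure R).
Local Open Scope ereal_scope.

Let restrict_indic (D : set (measurableTypeR R)) (f : R -> \bar R) :
  \int[mu]_(r in D) f r = \int[mu]_r (f r * (\1_D r)%:E).
Proof. by rewrite integral_mkcond; apply: eq_integral => r _; rewrite epatch_indic. Qed.

Let measurable_restrict (D : set (measurableTypeR R))
    (f : Om * measurableTypeR R -> \bar R) : measurable D ->
  measurable_fun setT f -> measurable_fun setT (fun z => f z * (\1_D z.2)%:E).
Proof.
move=> mD mf; apply: emeasurable_funM => //; apply/measurable_EFinP.
have m1 : measurable_fun setT (\1_D : measurableTypeR R -> R) by exact: measurable_indic.
exact: measurableT_comp m1 measurable_snd.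
Qed.

Lemma measurable_inner_integral (D : set (measurableTypeR R))
    (f : Om * measurableTypeR R -> \bar R) :
  measurable D -> measurable_fun setT f -> (forall z, 0 <= f z) ->
  measurable_fun setT (fun w => \int[mu]_(r in D) f (w, r)).
Proof.
move=> mD mf f0; under eq_fun do rewrite restrict_indic.
apply: (measurable_fun_fubini_tonelli_F (fun z => f z * (\1_D z.2)%:E)) => //.
  exact: measurable_restrict.
by move=> z; rewrite mule_ge0// lee_fin.
Qed.

Lemma integral_exchange (D : set (measurableTypeR R))
    (f : Om * measurableTypeR R -> \bar R) :
  measurable D -> measurable_fun setT f -> (forall z, 0 <= f z) ->
  \int[P]_w \int[mu]_(r in D) f (w, r) = \int[mu]_(r in D) \int[P]_w f (w, r).
Proof.
move=> mD mf f0; under eq_integral do rewrite restrict_indic.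
rewrite restrict_indic.
rewrite (fubini_tonelli (fun z => f z * (\1_D z.2)%:E)); last 2 first.
- exact: measurable_restrict.
- by move=> z; rewrite mule_ge0// lee_fin.
apply: eq_integral => r _ /=; rewrite ge0_integralZr//.
exact: measurable_fun_pair1.
Qed.

Lemma double_integral_sqrD_le (D : set (measurableTypeR R)) (f g : Om * measurableTypeR R -> R) :
  measurable D -> measurable_fun setT f -> measurable_fun setT g ->
  \int[P]_w \int[mu]_(r in D) ((f (w, r) + g (w, r)) ^+ 2)%:E <=
  2%:E * \int[P]_w \int[mu]_(r in D) (f (w, r) ^+ 2)%:E +
  2%:E * \int[P]_w \int[mu]_(r in D) (g (w, r) ^+ 2)%:E.
Proof.
move=> mD mf mg.
have msq (h : Om * measurableTypeR R -> R) : measurable_fun setT h ->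
    measurable_fun setT (fun z => (h z ^+ 2)%:E).
  by move=> mh; apply/measurable_EFinP; exact: measurable_funX.
have inner (h : Om * measurableTypeR R -> R) : measurable_fun setT h ->
    measurable_fun setT (fun w => \int[mu]_(r in D) (h (w, r) ^+ 2)%:E).
  move=> mh; apply: (measurable_inner_integral (f := fun z => (h z ^+ 2)%:E)) => //.
    exact: msq.
  by move=> z; rewrite lee_fin sqr_ge0.
have inner0 (h : Om * measurableTypeR R -> R) w : 0 <= \int[mu]_(r in D) (h (w, r) ^+ 2)%:E.
  by apply: integral_ge0 => r _; rewrite lee_fin sqr_ge0.
rewrite -!ge0_integralZl_EFin//; [|exact: inner..].
rewrite -ge0_integralD//; last 4 first.
- by move=> w _; rewrite mule_ge0.
- by apply: emeasurable_funM => //; exact: inner.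
- by move=> w _; rewrite mule_ge0.
- by apply: emeasurable_funM => //; exact: inner.
apply: ge0_le_integral => //.
- by move=> w _; apply: integral_ge0 => r _; rewrite lee_fin sqr_ge0.
- exact: (inner (fun z => f z + g z)%R (measurable_funD mf mg)).
- by apply: emeasurable_funD; apply: emeasurable_funM => //; exact: inner.
move=> w _.
have sec (h : Om * measurableTypeR R -> R) : measurable_fun setT h ->
    measurable_fun D (fun r => (h (w, r) ^+ 2)%:E).
  by move=> mh; apply: measurable_funTS; apply: measurable_fun_pair2 (msq h mh).
have ge0 (h : Om * measurableTypeR R -> R) r : 0 <= (h (w, r) ^+ 2)%:E by rewrite lee_fin sqr_ge0.
rewrite -!ge0_integralZl_EFin//; [|exact: sec..].
rewrite -ge0_integralD//; last 4 first.
- by move=> r _; rewrite mule_ge0.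
- by apply: emeasurable_funM => //; exact: sec.
- by move=> r _; rewrite mule_ge0.
- by apply: emeasurable_funM => //; exact: sec.
apply: ge0_le_integral => //.
- by move=> r _; rewrite lee_fin sqr_ge0.
- exact: (sec (fun z => f z + g z)%R (measurable_funD mf mg)).
- by apply: emeasurable_funD; apply: emeasurable_funM => //; exact: sec.
move=> r _; rewrite -!EFinM -EFinD lee_fin -subr_ge0.
rewrite (_ : (_ - _)%R = ((f (w, r) - g (w, r)) ^+ 2)%R) ?sqr_ge0//; ring.
Qed.

End double_integral.

(** * Step processes *)

Section path_measurability.
Context {R : realType} {d : measure_display} {Om : measurableType d}.
Local Notation mu := (@lebesgue_measure R).

Lemma grid_cvg (r : R) :
  (Num.floor (n.+1%:R * r))%:~R / n.+1%:R @[n --> \oo] --> r.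
Proof.
have lo n : r - n.+1%:R^-1 <= (Num.floor (n.+1%:R * r))%:~R / n.+1%:R.
  rewrite lerBlDr -[X in _ + X]mul1r -mulrDl ler_pdivlMr ?ltr0n// mulrC ltW//.
  by rewrite -[1]/(1%:~R) -intrD floorD1_gt.
have hi n : (Num.floor (n.+1%:R * r))%:~R / n.+1%:R <= r.
  by rewrite ler_pdivrMr ?ltr0n// mulrC floor_le.
apply: (@squeeze_cvgr _ _ _ _ (fun n => r - n.+1%:R^-1) (cst r)).
- by apply: nearW => n; rewrite lo hi.
- rewrite -[X in _ --> X]subr0; apply: cvgB; first exact: cvg_cst.
  exact: cvg_harmonic.
- exact: cvg_cst.
Qed.

(** Sampling the time on the grid of step [1 / n.+1] gives a function that is
    measurable on each of countably many strips, and continuity of the paths gives the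
    limit. *)
Lemma continuous_paths_measurable (X : R -> Om -> R) :
  (forall r, measurable_fun setT (X r)) -> (forall w, continuous (X ^~ w)) ->
  measurable_fun setT (fun z : Om * measurableTypeR R => X z.2 z.1).
Proof.
move=> mX cX; pose g n (r : R) : R := (Num.floor (n.+1%:R * r))%:~R / n.+1%:R.
apply: (measurable_fun_cvg (h := fun n z => X (g n z.2) z.1)); last first.
  by move=> [w r] _ /=; exact: cvg_comp (@grid_cvg r) (cX w r).
move=> n _ B mB; rewrite setTI.
have -> : (fun z : Om * measurableTypeR R => X (g n z.2) z.1) @^-1` B =
    \bigcup_(k : int) ((X (k%:~R / n.+1%:R) @^-1` B) `*`
      ([set r | k%:~R <= n.+1%:R * r < (k + 1)%:~R] : set (measurableTypeR R))).
  apply/seteqP; split=> [[w r] /= XB|[w r] [k _] [/= XB kr]].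
    by exists (Num.floor (n.+1%:R * r)) => //; split => //=; exact: floor_itv.
  by rewrite /g (floor_def kr).
apply: countable_bigcupT_measurable => [|k]; first exact: countableP.
apply: measurableX; first by rewrite -[X in measurable X]setTI; exact: mX.
have -> : [set r : R | k%:~R <= n.+1%:R * r < (k + 1)%:~R] =
    ( *%R n.+1%:R) @^-1` `[k%:~R, (k + 1)%:~R[.
  by apply/seteqP; split => r /=; rewrite in_itv.
rewrite -[X in measurable X]setTI.
by apply: (mulrl_measurable (D := setT) (n.+1%:R : R)).
Qed.

End path_measurability.

Section simple_integral.
Context {R : realType} {d : measure_display} {Om : measurableType d}.
Variables (P : probability Om R) (F : R -> set (set Om)) (W : R -> Om -> R).
Hypotheses (hF : usual_conditions P F) (hW : brownian_motion P F W).
Local Notation L1 := (Lfun P 1%E).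
Local Notation L2 := (Lfun P 2%:E).
Local Notation mu := (@lebesgue_measure R).

Section one_process.
Variables (N : nat) (tau : nat -> R) (v : nat -> Om -> R).

Definition step_eval (r : R) (w : Om) : R :=
  \sum_(i < N) \1_(`]tau i, tau i.+1]%classic) r * v i w.

Definition step_int (t : R) (w : Om) : R :=
  \sum_(i < N) v i w *
    (W (Num.min t (tau i.+1)) w - W (Num.min t (tau i)) w).

Definition adapted_step := [/\ 0 <= tau 0,
  forall i, tau i <= tau i.+1
  & forall i, (i < N)%N -> L2_at P F (tau i) (v i)].

Hypothesis Hstep : adapted_step.

Lemma step_time_ge0 i : 0 <= tau i.
Proof.
case: Hstep => t0 tS _; elim: i => // i IH; exact: le_trans (tS i).
Qed.

Variables (s t : R) (x : Om -> R).
Hypotheses (s0 : 0 <= s) (st : s <= t) (xs : L2_at P F s x).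

(** The times of the process, moved into [[s, t]]; [aa], [bb], [cc] describe the step
    process minus the constant [x] on [(s, t]] as an elementary integrand. Pieces that
    become empty get the coefficient 0, since their own one need not be known at time
    [alpha j]. *)
Let alpha i := Num.max s (Num.min t (tau i)).
Let aa (i : option nat) := if i is Some j then alpha j else s.
Let bb (i : option nat) := if i is Some j then alpha j.+1 else t.
Let cc (i : option nat) : Om -> R := if i is Some j then
  (if (j < N)%N && (alpha j < alpha j.+1) then v j else cst 0) else - x.
Let ll : seq (option nat) := None :: map Some (index_iota 0 N).

Let aa0 i : 0 <= aa i.
Proof. by case: i => [j|]//=; rewrite /alpha le_max s0. Qed.

Let aabb i : aa i <= bb i.
Proof.
case: i => [j|]//=; case: Hstep => _ tS _.
rewrite /alpha; have := tS j; case: (leP t (tau j)); case: (leP t (tau j.+1)) => h1 h2 h3;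
  rewrite ?ge_max ?le_max ?lexx ?h3 ?orbT//=.
- by rewrite (le_trans h2 h3) ?orbT.
- by rewrite (ltW h2) ?orbT.
Qed.

Let cc2 i : L2_at P F (aa i) (cc i).
Proof.
case: i => [j|] /=; last by rewrite -scaleN1r; exact: L2_atZ.
case: ifPn => [/andP[jN aj]|_]; last exact: L2_at_cst.
case: Hstep => _ tS v2; apply: (L2_at_le hF) (v2 j jN); first exact: step_time_ge0.
rewrite /alpha le_max; apply/orP; right; move: aj; rewrite /alpha.
case: (leP t (tau j)) => // tj; rewrite (min_l (le_trans tj (tS j))) ltxx//.
Qed.

Let clamp_increment (r : R) (w : Om) :
  W (Num.min t r) w - W (Num.min s r) w = W (Num.max s (Num.min t r)) w - W s w.
Proof.
case: (leP t r) => tr.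
  by rewrite (max_r st) (min_l (le_trans st tr)).
case: (leP s r) => sr //.
by rewrite subrr subrr.
Qed.

Let elem_intE : elem_int W ll aa bb cc =
  step_int t - step_int s - x * (W t - W s).
Proof.
apply/funext => w; rewrite /elem_int /ll big_cons big_map /=.
have sumE (J : Type) (q : seq J) (f : J -> Om -> R) :
    (\sum_(i <- q) f i) w = \sum_(i <- q) f i w.
  by elim/big_rec2: _ => // i p y _ <-.
rewrite -[LHS]/(- x w * (W t w - W s w) + (\sum_(j <- index_iota 0 N)
  cc (Some j) * (W (alpha j.+1) - W (alpha j))) w) sumE.
rewrite -[RHS]/(step_int t w - step_int s w - x w * (W t w - W s w)).
rewrite addrC mulNr; congr (_ - _).
rewrite /step_int -!(big_mkord xpredT
  (fun i => v i w * (W (Num.min _ (tau i.+1)) w - W (Num.min _ (tau i)) w))).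
rewrite -sumrB big_seq [RHS]big_seq; apply: eq_bigr => j.
rewrite mem_index_iota => /andP[_ jN].
have swap (p q r z : R) : p - q - (r - z) = p - r - (q - z) by ring.
rewrite -mulrBr swap !clamp_increment -/(alpha j.+1) -/(alpha j) /= jN /=.
have := aabb (Some j); rewrite /= le_eqVlt => /predU1P[->|aj].
  by rewrite ltxx /= -[LHS]/(0 * _) mul0r; ring.
rewrite aj -[LHS]/(v j w * (W (alpha j.+1) w - W (alpha j) w)); ring.
Qed.

Let elem_funE (w : Om) (r : R) : s < r <= t ->
  elem_fun ll aa bb cc w r = step_eval r w - x w.
Proof.
move=> /andP[sr rt]; rewrite /elem_fun /ll big_cons big_map /=.
rewrite addrC; congr (_ + _); last first.
  by rewrite indicE mem_set ?mulr1//= in_itv/= sr rt.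
rewrite /step_eval -(big_mkord xpredT (fun i => \1_(`]tau i, tau i.+1]%classic) r * v i w)).
rewrite big_seq [RHS]big_seq; apply: eq_bigr => j.
rewrite mem_index_iota => /andP[_ jN]; rewrite jN /= mulrC.
have E : (r \in `]alpha j, alpha j.+1]) = (r \in `]tau j, tau j.+1]).
  by rewrite !in_itv/= /alpha gt_max sr /= gt_min [t < r]ltNge rt /=
    le_max [r <= s]leNgt sr /= le_min rt.
rewrite !indicE !mem_setE E.
case: ifPn => //; rewrite -leNgt => aj.
case: (boolP (r \in `]tau j, tau j.+1])) => [|_]; last by rewrite !mul0r.
rewrite -E in_itv/= => /andP[r1 r2].
by have := lt_le_trans r1 (le_trans r2 aj); rewrite ltxx.
Qed.

Lemma step_increment_isometry :
  step_int t - step_int s - x * (W t - W s) \in L2 /\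
  (\int[P]_w \int[mu]_(r in `]s, t]) ((step_eval r w - x w) ^+ 2)%:E =
   (mean P ((step_int t - step_int s - x * (W t - W s)) ^+ 2))%:E)%E.
Proof.
rewrite -elem_intE; split; first exact: (elem_int_L2 hF hW).
have sub i : `]aa i, bb i] `<=` `]s, t].
  apply: subset_itv; rewrite bnd_simp.
    by case: i => [j|]//=; rewrite /alpha le_max lexx.
  by case: i => [j|]//=; rewrite /alpha ge_max st /= ge_min lexx.
rewrite -(elem_isometry hF hW ll aa0 aabb cc2 (measurable_itv _) sub).
apply: eq_integral => w _; apply: eq_integral => r.
by rewrite inE/= in_itv/= => srt; rewrite elem_funE.
Qed.

(** Each increment starts at time [s] or later, and is multiplied by variables
    known at its start. *)
Lemma step_increment_orthogonal y : L2_at P F s y ->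
  mean P (y * (step_int t - step_int s - x * (W t - W s))) = 0.
Proof.
move=> ys; rewrite -elem_intE /elem_int mulr_sumr.
have cd i : cc i * (W (bb i) - W (aa i)) \in L2.
  by have [[]] := mul_increment_L2 hF hW (aa0 i) (aabb i) (cc2 i).
have y2 : y \in L2 by case: ys.
rewrite mean_sum; last by move=> i; rewrite L2M.
apply: big1 => i _; rewrite mulrA.
have saa : s <= aa i by case: (i) => [j|]//=; rewrite /alpha le_max lexx.
have [my _] := L2_at_le hF s0 saa ys; have [mc c2] := cc2 i.
have myc : measurable_wrt (F (aa i)) (y * cc i) by exact: measurable_funM.
by have [] := mean_mul_increment hF hW (aa0 i) (aabb i) myc (L2M y2 c2).
Qed.

End one_process.

End simple_integral.

(** * Stochastic integrals of scalar processes *)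

Section ito.
Context {R : realType} {d : measure_display} {Om : measurableType d}.
Variables (P : probability Om R) (F : R -> set (set Om)) (W : R -> Om -> R).
Hypotheses (hF : usual_conditions P F) (hW : brownian_motion P F W).
Local Notation L1 := (Lfun P 1%E).
Local Notation L2 := (Lfun P 2%:E).
Local Notation mu := (@lebesgue_measure R).

(** Young's inequality, from the square of [e *: X - Y]; letting [e] vary, it plays
    the role of the Cauchy-Schwarz inequality. *)
Lemma mean_mul_le (X Y : Om -> R) (e : R) : 0 < e -> X \in L2 -> Y \in L2 ->
  2 * mean P (X * Y) <= e * mean P (X ^+ 2) + mean P (Y ^+ 2) / e.
Proof.
move=> e0 X2 Y2; have := mean_sqr_ge0 P (e *: X - Y).
have -> : (e *: X - Y) ^+ 2 = e ^+ 2 *: X ^+ 2 + (- (2 * e)) *: (X * Y) + Y ^+ 2.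
  by fring.
rewrite meanD ?rpredD ?L1Z ?L2M ?L2_sqr// meanD ?L1Z ?L2M ?L2_sqr//.
rewrite !meanZ ?L2M ?L2_sqr// => h.
rewrite -(ler_pM2l e0) mulrDr (mulrC e (_ / e)) divfK ?gt_eqF//.
by rewrite -subr_ge0; move: h; rewrite (_ : _ + _ = e * (e * mean P (X ^+ 2)) +
  mean P (Y ^+ 2) - e * (2 * mean P (X * Y))) //; ring.
Qed.

Lemma step_int0 N tau v : adapted_step P F N tau v -> step_int W N tau v 0 = 0.
Proof.
move=> H; apply/funext => w; rewrite /step_int; apply: big1 => i _.
by rewrite !(min_l (step_time_ge0 H _)) subrr mulr0.
Qed.

Lemma step_int_L2 N tau v t : adapted_step P F N tau v -> 0 <= t ->
  step_int W N tau v t \in L2.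
Proof.
move=> H t0; have [+ _] := step_increment_isometry hF hW H (lexx 0) t0 (L2_at_cst P F 0 0).
by rewrite step_int0// subr0 (_ : cst 0 = 0)// mul0r subr0.
Qed.

Lemma step_eval_measurable N tau v : adapted_step P F N tau v ->
  measurable_fun setT (fun z : Om * measurableTypeR R => step_eval N tau v z.2 z.1).
Proof.
move=> H; have [_ _ v2] := H.
apply: measurable_sum => i; apply: measurable_funM.
  have m1 : measurable_fun setT
      (\1_(`]tau i, tau i.+1]%classic) : measurableTypeR R -> R).
    by apply: measurable_indic; exact: measurable_itv.
  exact: measurableT_comp m1 measurable_snd.
have [_ vi] := v2 i (ltn_ord i).
exact: measurableT_comp (L2_measurable vi) measurable_fst.
Qed.

(** What the definition of the stochastic integral of a process with values in
    [H^g] gives for one coordinate. *)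
Definition scalar_ito (X I : R -> Om -> R) :=
  (forall t, 0 <= t -> measurable_wrt (F t) (I t)) /\
  forall T, 0 < T -> exists N tau v,
    [/\ forall n : nat, adapted_step P F (N n) (tau n) (v n),
        (\int[P]_w \int[mu]_(r in `[0%R, T])
           ((step_eval (N n) (tau n) (v n) r w - X r w) ^+ 2)%:E)%E
          @[n --> \oo] --> 0%E
      & forall t, 0 <= t -> t <= T ->
        (\int[P]_w ((step_int W (N n) (tau n) (v n) t w - I t w) ^+ 2)%:E)%E
          @[n --> \oo] --> 0%E].

Variables X I : R -> Om -> R.
Hypothesis mX : measurable_fun setT (fun z : Om * measurableTypeR R => X z.2 z.1).
Hypothesis XI : scalar_ito X I.

Lemma scalar_ito_L2 t : 0 <= t -> L2_at P F t (I t).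
Proof.
move=> t0; case: XI => mI /(_ (t + 1)) [|N [tau [v [H _ J]]]].
  by rewrite ltr_wpDl.
split; first exact: mI.
have mIt : measurable_fun setT (I t).
  apply: measurable_wrt_measurable (mI t t0); first exact: (filtration_sigma hF).
  exact: (filtration_measurable hF).
have /fine_cvgP[fin _] := J t t0 (ltW (ltr_pwDr ltr01 (lexx t))).
near \oo => n.
have : (\int[P]_w ((step_int W (N n) (tau n) (v n) t w - I t w) ^+ 2)%:E \is a fin_num)%E.
  by near: n.
have Jn2 := step_int_L2 (H n) t0.
rewrite ge0_fin_numE; last by apply: integral_ge0 => w _; rewrite lee_fin sqr_ge0.
move=> ltoo; have D2 : step_int W (N n) (tau n) (v n) t - I t \in L2.
  apply: L2P => //.
  by apply: measurable_funB => //; exact: L2_measurable Jn2.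
rewrite (_ : I t = step_int W (N n) (tau n) (v n) t -
  (step_int W (N n) (tau n) (v n) t - I t)); first exact: L2B.
by fring.
Unshelve. all: by end_near. Qed.

Section increment.
Variables (s t K : R) (x : Om -> R).
Hypotheses (s0 : 0 <= s) (st : s <= t) (xs : L2_at P F s x).
Hypothesis XK :
  (\int[P]_w \int[mu]_(r in `]s, t]) ((X r w - x w) ^+ 2)%:E <= K%:E)%E.
Let t0 : 0 <= t := le_trans s0 st.
Let Delta := I t - I s - x * (W t - W s).

Lemma ito_increment_L2_at : L2_at P F t Delta.
Proof.
apply: L2_atB; last by have [] := mul_increment_L2 hF hW s0 st xs.
apply: L2_atB; first exact: scalar_ito_L2.
by apply: L2_at_le s0 st _ => //; exact: scalar_ito_L2.
Qed.

(** [D] is the integral over [(s, t]] of a step process close to [X], minus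
    [x * (W t - W s)]. The factor 2 comes from comparing the step process with [X] first,
    and [X] with [x] next. *)
Lemma ito_increment_approx (e : R) : 0 < e -> exists D : Om -> R,
  [/\ D \in L2, mean P ((Delta - D) ^+ 2) <= e,
      mean P (D ^+ 2) <= 2 * K + e
    & forall y, L2_at P F s y -> mean P (y * D) = 0].
Proof.
move=> e0; case: XI => mI /(_ (t + 1)) [|N [tau [v [H S J]]]].
  by rewrite ltr_wpDl.
have tT : t <= t + 1 by rewrite ltW// ltrDl.
pose Jn n r := step_int W (N n) (tau n) (v n) r.
have e4 : 0 < e / 4 by rewrite divr_gt0.
have small r : 0 <= r -> r <= t ->
    \forall n \near \oo, mean P ((Jn n r - I r) ^+ 2) <= e / 4.
  move=> r0 rt; have := J r r0 (le_trans rt tT) => /fine_cvgP[_].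
  move=> /cvgrPdist_le /(_ _ e4); apply: filterS => n.
  rewrite sub0r normrN ger0_norm; last first.
    by apply: fine_ge0; apply: integral_ge0 => w _; rewrite lee_fin sqr_ge0.
  have D2 : Jn n r - I r \in L2.
    by apply: L2B; [exact: step_int_L2|have [] := scalar_ito_L2 r0].
  by rewrite /= (integral_sqr D2).
have smallS : \forall n \near \oo, (\int[P]_w \int[mu]_(r in `[0%R, (t + 1)%R])
    ((step_eval (N n) (tau n) (v n) r w - X r w) ^+ 2)%:E <= (e / 2)%:E)%E.
  have /fine_cvgP[fin] := S.
  have e2 : 0 < e / 2 by rewrite divr_gt0.
  move=> /cvgrPdist_le /(_ _ e2); apply: filterS2 fin => n fin.
  rewrite sub0r normrN ger0_norm; last first.
    by apply: fine_ge0; apply: integral_ge0 => w _; apply: integral_ge0 => r _;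
      rewrite lee_fin sqr_ge0.
  by rewrite -lee_fin fineK.
near \oo => n.
have Jt : mean P ((Jn n t - I t) ^+ 2) <= e / 4 by near: n; exact: small.
have Js : mean P ((Jn n s - I s) ^+ 2) <= e / 4 by near: n; exact: small.
have Sn : (\int[P]_w \int[mu]_(r in `[0%R, (t + 1)%R])
    ((step_eval (N n) (tau n) (v n) r w - X r w) ^+ 2)%:E <= (e / 2)%:E)%E.
  by near: n.
have [D2 isoD] := step_increment_isometry hF hW (H n) s0 st xs.
have I2 r : 0 <= r -> I r \in L2 by move=> r0; have [] := scalar_ito_L2 r0.
have J2 r : 0 <= r -> Jn n r \in L2 by move=> r0; exact: step_int_L2.
exists (Jn n t - Jn n s - x * (W t - W s)); split => //.
- rewrite (_ : Delta - _ = (Jn n s - I s) - (Jn n t - I t)); last first.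
    by rewrite /Delta; fring.
  apply: le_trans (mean_sqrB_le _ _) _; [by apply: L2B; [exact: J2|exact: I2]..|].
  lra.
- rewrite -lee_fin -isoD.
  pose f (z : Om * measurableTypeR R) := step_eval (N n) (tau n) (v n) z.2 z.1 - X z.2 z.1.
  pose g (z : Om * measurableTypeR R) := X z.2 z.1 - x z.1.
  have mf : measurable_fun setT f.
    by apply: measurable_funB => //; exact: step_eval_measurable.
  have mg : measurable_fun setT g.
    apply: measurable_funB => //; apply: measurableT_comp measurable_fst.
    by case: xs => _; exact: L2_measurable.
  have dbl : (\int[P]_w \int[mu]_(r in `]s, t])
      ((step_eval (N n) (tau n) (v n) r w - x w) ^+ 2)%:E <=
    2%:E * \int[P]_w \int[mu]_(r in `]s, t])
      ((step_eval (N n) (tau n) (v n) r w - X r w) ^+ 2)%:E +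
    2%:E * \int[P]_w \int[mu]_(r in `]s, t]) ((X r w - x w) ^+ 2)%:E)%E.
    apply: le_trans (double_integral_sqrD_le P (measurable_itv `]s, t]) mf mg).
    rewrite le_eqVlt; apply/orP; left; apply/eqP.
    apply: eq_integral => w _; apply: eq_integral => r _.
    by rewrite /f /g /= addrA subrK.
  apply: le_trans dbl _; rewrite [(2 * K + e)%R]addrC [leRHS]EFinD; apply: leeD.
    have -> : (e%:E = 2%:E * (e / 2)%:E)%E by rewrite -EFinM mulrC divfK.
    apply: lee_wpmul2l; first by rewrite lee_fin.
    apply: le_trans Sn.
    have msq : measurable_fun setT (fun z => (f z ^+ 2)%:E).
      by apply/measurable_EFinP; exact: measurable_funX.
    have sq0 z : (0 <= (f z ^+ 2)%:E)%E by rewrite lee_fin sqr_ge0.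
    apply: ge0_le_integral => //.
    + by move=> w _; apply: integral_ge0 => r _; exact: (sq0 (w, r)).
    + exact: (measurable_inner_integral (measurable_itv `]s, t]) msq sq0).
    + exact: (measurable_inner_integral (measurable_itv `[0, (t + 1)]) msq sq0).
    + move=> w _; apply: ge0_subset_integral => //.
      * by apply: measurable_funTS; exact: (measurable_fun_pair2 w msq).
      * by move=> r _; exact: (sq0 (w, r)).
      * by apply: subset_itv; rewrite bnd_simp.
  by rewrite EFinM; apply: lee_wpmul2l => //; rewrite lee_fin.
- move=> y ys; exact: (step_increment_orthogonal hF hW (H n) s0 st xs ys).
Unshelve. all: by end_near. Qed.

Lemma ito_increment_sqr : mean P (Delta ^+ 2) <= 4 * K.
Proof.
apply/ler_addgt0Pr => e e0.
have [D [D2 h1 h2 _]] := ito_increment_approx (divr_gt0 e0 (ltr0n _ 4)).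
have [_ X2] := ito_increment_L2_at.
rewrite (_ : Delta = (Delta - D) + D); last by fring.
apply: le_trans (mean_sqrD_le _ D2) _; first exact: L2B.
lra.
Qed.

Lemma ito_increment_orthogonal y : L2_at P F s y -> mean P (y * Delta) = 0.
Proof.
have le0 z : L2_at P F s z -> mean P (z * Delta) <= 0.
  move=> zs; have [_ z2] := zs; have [_ X2] := ito_increment_L2_at.
  apply/ler_addgt0Pr => e e0; rewrite add0r.
  pose M := mean P (z ^+ 2) + 1.
  have M0 : 0 < M by rewrite ltr_wpDl// mean_sqr_ge0.
  have h0 : 0 < e / M by rewrite divr_gt0.
  have [D [D2 h1 _ o]] := ito_increment_approx (exprn_gt0 2 h0).
  have B2 : Delta - D \in L2 by exact: L2B.
  have -> : mean P (z * Delta) = mean P (z * (Delta - D)).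
    by rewrite [in RHS]mulrBr meanB ?L2M// (o z zs) subr0.
  have := mean_mul_le h0 z2 B2.
  have h3 : mean P ((Delta - D) ^+ 2) / (e / M) <= e / M.
    by rewrite ler_pdivrMr// -expr2.
  have h4 : e / M * mean P (z ^+ 2) + e / M = e.
    by rewrite -[X in _ + X]mulr1 -mulrDr divfK ?gt_eqF.
  lra.
move=> ys; apply/eqP; rewrite eq_le le0//= -oppr_le0.
have := le0 (-1 *: y) (L2_atZ (-1) ys).
rewrite (_ : -1 *: y * Delta = -1 *: (y * Delta)); last by fring.
have [_ y2] := ys; have [_ X2] := ito_increment_L2_at.
by rewrite meanZ ?L2M// mulN1r.
Qed.

End increment.

End ito.

(** * Uniqueness from local expansions *)

Section local_expansion.
Context {R : realType} {d : measure_display} {Om : measurableType d}.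
Variables (P : probability Om R) (F : R -> set (set Om)) (W : R -> Om -> R).
Hypotheses (hF : usual_conditions P F) (hW : brownian_motion P F W).
Local Notation L2 := (Lfun P 2%:E).
Variables (lam T : R).
Hypothesis lam0 : 0 <= lam.

(** A first order expansion of [dZ = - lam Z dt + Z dW] over a short interval: the
    systematic error [p] must be of higher order than the error [q], whose
    contributions over successive intervals only add up in square, because it is
    orthogonal to the past. *)
Definition expands (C : R) (Z : R -> Om -> R) :=
  (forall t, 0 <= t -> t <= T -> L2_at P F t (Z t)) /\
  forall s t, 0 <= s -> s < t -> t <= T -> t - s <= 2^-1 -> exists p q,
    [/\ Z t = (1 - lam * (t - s)) *: Z s + (Z s * (W t - W s) + q) + p,
        p \in L2 /\ mean P (p ^+ 2) <= C * (t - s) ^+ 3,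
        q \in L2 /\ mean P (q ^+ 2) <= C * (t - s) ^+ 2
      & forall y, L2_at P F s y -> mean P (y * q) = 0].

Lemma expandsB C1 C2 Z1 Z2 : expands C1 Z1 -> expands C2 Z2 ->
  expands (2 * C1 + 2 * C2) (fun t => Z1 t - Z2 t).
Proof.
move=> [m1 e1] [m2 e2]; split=> [t t0 tT|s t s0 st tT h1].
  by apply: L2_atB; [exact: m1|exact: m2].
have [p1 [q1 [E1 [p12 P1] [q12 Q1] O1]]] := e1 s t s0 st tT h1.
have [p2 [q2 [E2 [p22 P2] [q22 Q2] O2]]] := e2 s t s0 st tT h1.
exists (p1 - p2), (q1 - q2); split.
- by rewrite E1 E2; fring.
- split; first exact: L2B.
  by apply: le_trans (mean_sqrB_le _ _) _ => //; lra.
- split; first exact: L2B.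
  by apply: le_trans (mean_sqrB_le _ _) _ => //; lra.
- by move=> y ys; have [_ y2] := ys; rewrite mulrBr meanB ?L2M// O1// O2// subrr.
Qed.

Let K := 2 * lam ^+ 2 + 5.

(** [Z s] is orthogonal to [Z s * (W t - W s) + q], so that part only adds
    [O(h)] times [E Z_s^2] plus [O(h^2)]; the cross term with [p] is split with
    weights [h] and [1 / h], which is why [E p^2] has to be of order [h^3]. *)
Lemma expands_step C Z s t : 0 <= C -> expands C Z ->
  0 <= s -> s < t -> t <= T -> t - s <= 2^-1 ->
  mean P (Z t ^+ 2) <=
    (1 + K * (t - s)) * mean P (Z s ^+ 2) + 6 * C * (t - s) ^+ 2.
Proof.
move=> C0 [m e] s0 st tT h1; have [p [q [-> [p2 Pp] [q2 Qq] O]]] := e s t s0 st tT h1.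
set h := t - s in h1 Pp Qq *.
have h0 : 0 < h by rewrite subr_gt0.
have Zs := m s s0 (le_trans (ltW st) tT); have [_ Z2] := Zs.
have [[_ D2] ED] := mul_increment_L2 hF hW s0 (ltW st) Zs.
have [mZZ Z21] : measurable_wrt (F s) (Z s * Z s) /\ Z s * Z s \in Lfun P 1%E.
  by split; [apply: measurable_funM; case: Zs|exact: L2M].
have [_ OD] := mean_mul_increment hF hW s0 (ltW st) mZZ Z21.
set B := Z s * (W t - W s) + q.
have B2 : B \in L2 by exact: L2D.
have ZB : mean P (Z s * B) = 0.
  by rewrite mulrDr meanD ?L2M// O// mulrA OD addr0.
have MB : mean P (B ^+ 2) <= 2 * (mean P (Z s ^+ 2) * h) + 2 * (C * h ^+ 2).
  by apply: le_trans (mean_sqrD_le _ _) _ => //; rewrite ED -/h; lra.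
set A := (1 - lam * h) *: Z s + B.
have A2 : A \in L2 by apply: L2D => //; exact: L2Z.
have MA : mean P (A ^+ 2) = (1 - lam * h) ^+ 2 * mean P (Z s ^+ 2) + mean P (B ^+ 2).
  rewrite mean_sqrD ?L2Z// mean_sqrZ//.
  rewrite (_ : _ *: Z s * B = (1 - lam * h) *: (Z s * B)); last by fring.
  by rewrite meanZ ?L2M// ZB !mulr0 addr0.
rewrite mean_sqrD//.
have cross := mean_mul_le h0 A2 p2.
have ph : mean P (p ^+ 2) / h <= C * h ^+ 2.
  by rewrite ler_pdivrMr// -mulrA -exprSr.
set g := mean P (Z s ^+ 2) in MB MA *.
have g0 : 0 <= g := mean_sqr_ge0 P (Z s).
have h1' : h <= 1 by lra.
have hh : h ^+ 2 <= h by rewrite expr2 ler_piMl// ltW.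
have a0 : mean P (A ^+ 2) <= (1 + (lam ^+ 2 + 2) * h) * g + 2 * C * h ^+ 2.
  have i1 : lam ^+ 2 * h ^+ 2 * g <= lam ^+ 2 * h * g.
    by rewrite ler_wpM2r// ler_wpM2l ?sqr_ge0.
  have i2 : 0 <= lam * h * g by do !apply: mulr_ge0 => //; exact: ltW.
  rewrite MA (_ : (1 - lam * h) ^+ 2 * g = g - 2 * (lam * h * g) + lam ^+ 2 * h ^+ 2 * g).
    lra.
  by ring.
have a0h : h * mean P (A ^+ 2) <=
    h * ((1 + (lam ^+ 2 + 2) * h) * g + 2 * C * h ^+ 2) by rewrite ler_wpM2l// ltW.
have i3 : (lam ^+ 2 + 2) * h ^+ 2 * g <= (lam ^+ 2 + 2) * h * g.
  by rewrite ler_wpM2r// ler_wpM2l// addr_ge0 ?sqr_ge0.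
have i4 : C * h ^+ 3 <= C * h ^+ 2 / 2.
  rewrite exprS mulrCA mulrC ler_wpM2l// mulr_ge0// sqr_ge0.
  by [].
have e1 : h * ((1 + (lam ^+ 2 + 2) * h) * g + 2 * C * h ^+ 2) =
  h * g + (lam ^+ 2 + 2) * h ^+ 2 * g + 2 * (C * h ^+ 3) by ring.
have i5 : 0 <= C * h ^+ 2 by rewrite mulr_ge0// sqr_ge0.
rewrite /K; lra.
Qed.

(** Iterating [expands_step] on the grid of step [T / n] accumulates [n] errors of
    order [1 / n^2]. *)
Lemma expands_eq0 C Z : 0 <= C -> 0 < T -> expands C Z ->
  mean P (Z 0 ^+ 2) = 0 -> mean P (Z T ^+ 2) = 0.
Proof.
move=> C0 T0 eZ Z0; have K0 : 0 <= K by rewrite addr_ge0// mulr_ge0// sqr_ge0.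
(* [(1 + K h) ^+ n <= expR (K T)] on the grid of step [h = T / n]. *)
pose M := 6 * C * T ^+ 2 * expR (K * T).
have M0 : 0 <= M by rewrite /M; do !apply: mulr_ge0 => //; rewrite ?sqr_ge0 ?expR_ge0 ?(ltW T0).
have bound n : 2 * T <= n.+1%:R -> mean P (Z T ^+ 2) <= M / n.+1%:R.
  move=> Tn; pose h := T / n.+1%:R.
  have h0 : 0 < h by rewrite divr_gt0.
  have h2 : h <= 2^-1 by rewrite ler_pdivrMr// mulrC ler_pdivlMr// mulrC.
  have Kh : 1 <= 1 + K * h by rewrite lerDl mulr_ge0// ltW.
  have step i : (i <= n.+1)%N ->
      mean P (Z (i%:R * h) ^+ 2) <= i%:R * (6 * C * h ^+ 2) * (1 + K * h) ^+ i.
    elim: i => [_|i IH iN]; first by rewrite !mul0r Z0.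
    have dt : i.+1%:R * h - i%:R * h = h by rewrite -mulrBl -natrB// subSnn mul1r.
    have := @expands_step C Z (i%:R * h) (i.+1%:R * h) C0 eZ.
    rewrite dt; move/(_ _ _ _ h2); rewrite mulr_ge0// ?(ltW h0)// ltr_pM2r// ltr_nat.
    move=> /(_ isT (ltnSn i)) step; apply: le_trans (step _) _.
      by rewrite /h mulrCA ler_piMr ?(ltW T0)// ler_pdivrMr// mul1r ler_nat.
    have {IH} := IH (ltnW iN); rewrite -(ler_pM2l (lt_le_trans ltr01 Kh)) => IH.
    have q0 : 0 <= 6 * C * h ^+ 2 by apply: mulr_ge0; [exact: mulr_ge0|exact: sqr_ge0].
    have q1 : 6 * C * h ^+ 2 <= 6 * C * h ^+ 2 * (1 + K * h) ^+ i.+1.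
      by rewrite ler_peMr// exprn_ege1.
    have split1 (x y : R) : i.+1%:R * x * y = i%:R * x * y + x * y.
      by rewrite -natr1 mulrDl mul1r mulrDl.
    rewrite split1.
    apply: lerD => //.
    by apply: le_trans IH _; rewrite (exprS (1 + K * h) i) [leRHS]mulrCA.
  have := step n.+1 (leqnn _); rewrite {1}/h mulrCA mulfV ?mulr1 ?pnatr_eq0//.
  move/le_trans; apply.
  have -> : n.+1%:R * (6 * C * h ^+ 2) = 6 * C * T ^+ 2 / n.+1%:R.
    have key (N : R) : N != 0 -> N * (6 * C * (T / N) ^+ 2) = 6 * C * T ^+ 2 / N.
      by move=> N0; field.
    by rewrite /h key ?pnatr_eq0.
  rewrite /M [leRHS]mulrAC ler_wpM2l//.
    by do !apply: mulr_ge0 => //; rewrite ?sqr_ge0 ?invr_ge0 ?(ltW T0).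
  have -> : K * T = n.+1%:R * (K * h).
    by rewrite /h mulrCA [n.+1%:R * _]mulrCA mulfV ?mulr1 ?pnatr_eq0.
  rewrite expRM_natl lerXn2r// ?nnegrE ?expR_ge0 ?expR_ge1Dx//.
  by rewrite (le_trans ler01).
apply/eqP; rewrite eq_le mean_sqr_ge0 andbT; apply/ler_addgt0Pr => e e0.
rewrite add0r; pose n := Num.bound (Num.max (2 * T) (M / e)).
have nb : Num.max (2 * T) (M / e) <= n.+1%:R.
  apply: ltW; apply: lt_trans (_ : n%:R < _); last by rewrite ltr_nat.
  by apply: le_lt_trans (archi_boundP _); rewrite // le_max mulr_ge0// ltW.
apply: le_trans (bound n _) _; first by apply: le_trans nb; rewrite le_max lexx.
rewrite ler_pdivrMr// mulrC -ler_pdivrMr//.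
by apply: le_trans nb; rewrite le_max lexx orbT.
Qed.

End local_expansion.

(** * Local expansion of the exponential process *)

Section geometric_motion.
Context {R : realType} {d : measure_display} {Om : measurableType d}.
Variables (P : probability Om R) (F : R -> set (set Om)) (W : R -> Om -> R).
Hypotheses (hF : usual_conditions P F) (hW : brownian_motion P F W).
Local Notation L2 := (Lfun P 2%:E).
Variables (lam : R) (Y0 : Om -> R).
Hypotheses (lam0 : 0 <= lam) (Y02 : L2_at P F 0 Y0).

(** The solution of [dY = - lam Y dt + Y dW] with initial value [Y0]. *)
Definition geometric_motion (t : R) (w : Om) : R :=
  Y0 w * expR (W t w - W 0 w - (lam + 2^-1) * t).

Definition noise (s t : R) : Om -> R := wick (W t - W s) (t - s).

Lemma geometric_motion_step s t :
  geometric_motion t = expR (- (lam * (t - s))) *: (geometric_motion s * noise s t).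
Proof.
apply/funext => w; rewrite -[RHS]/(expR (- (lam * (t - s))) * (geometric_motion s w * noise s t w)).
have E : expR (W t w - W 0 w - (lam + 2^-1) * t) = expR (- (lam * (t - s))) *
    expR (W s w - W 0 w - (lam + 2^-1) * s) * expR (W t w - W s w - (t - s) / 2).
  by rewrite -!expRD; congr expR; field.
rewrite /geometric_motion E -[noise s t w]/(expR (W t w - W s w - (t - s) / 2)); ring.
Qed.

Lemma noise_factor s t Z (f : R -> R) : 0 <= s -> s < t -> measurable_fun setT f ->
  f \o (W t - W s) \in L2 -> L2_at P F s Z ->
  Z * (f \o (W t - W s)) \in L2 /\
  mean P ((Z * (f \o (W t - W s))) ^+ 2) =
    mean P (Z ^+ 2) * mean P ((f \o (W t - W s)) ^+ 2).
Proof.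
move=> s0 st mf f2 [mZ Z2]; apply: independent_L2M => //.
exact: (independent_comp (@measurable_id _ _ setT) mf
  (increment_independent hF hW s0 st mZ)).
Qed.

Lemma noise_orthogonal s t Z (f : R -> R) : 0 <= s -> s < t -> measurable_fun setT f ->
  f \o (W t - W s) \in L2 -> mean P (f \o (W t - W s)) = 0 -> L2_at P F s Z ->
  forall y, L2_at P F s y -> mean P (y * (Z * (f \o (W t - W s)))) = 0.
Proof.
move=> s0 st mf f2 Ef [mZ Z2] y [my y2]; rewrite mulrA.
have myZ : measurable_wrt (F s) (y * Z) by exact: measurable_funM.
rewrite independent_meanM ?L2M ?L2_L1// ?Ef ?mulr0//.
exact: (independent_comp (@measurable_id _ _ setT) mf
  (increment_independent hF hW s0 st myZ)).
Qed.

Lemma noise_L2 s t : 0 <= s -> s < t ->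
  [/\ noise s t \in L2, mean P (noise s t) = 1, mean P (noise s t ^+ 2) = expR (t - s)
    & mean P ((noise s t - cst 1 - (W t - W s)) ^+ 2) = expR (t - s) - 1 - (t - s)].
Proof.
move=> s0 st; have mD := increment_measurable hF hW s0 (ltW st).
have h0 : 0 < t - s by rewrite subr_gt0.
have law := increment_law hW s0 st.
have [N2 E2] := wick_L2 mD h0 law.
by split => //; [exact: mean_wick|exact: wick_linear].
Qed.

Lemma geometric_motion_L2_at t : 0 <= t -> L2_at P F t (geometric_motion t) /\
  mean P (geometric_motion t ^+ 2) <= mean P (Y0 ^+ 2) * expR t.
Proof.
rewrite le_eqVlt => /predU1P[<-|t0].
  have -> : geometric_motion 0 = Y0.
    by apply/funext => w; rewrite /geometric_motion mulr0 !subrr expR0 mulr1.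
  by rewrite expR0 mulr1.
have [N2 EN EN2 _] := noise_L2 (lexx 0) t0.
have g0 : geometric_motion 0 = Y0.
  by apply/funext => w; rewrite /geometric_motion mulr0 !subrr expR0 mulr1.
pose f (x : R) := expR (x - t / 2).
have fE : noise 0 t = f \o (W t - W 0).
  by apply/funext => w; rewrite /noise /wick subr0.
have mf : measurable_fun setT f by apply: measurableT_comp => //; exact: measurable_funB.
have f2 : f \o (W t - W 0) \in L2 by rewrite -fE.
have [YN2 EYN] := noise_factor (lexx 0) t0 mf f2 Y02.
rewrite (geometric_motion_step 0 t) g0 fE; split.
  split; last exact: L2Z.
  apply: measurable_funM; first exact: measurable_cst.
  apply: measurable_funM.
    by case: Y02 => mY _; exact: (measurable_wrt_le hF (lexx 0) (ltW t0)).
  apply: (measurableT_comp mf).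
  exact: (increment_measurable_wrt hF hW (lexx 0) (ltW t0)).
rewrite mean_sqrZ// EYN -fE EN2 subr0 ler_piMl//.
  by rewrite mulr_ge0 ?expR_ge0// mean_sqr_ge0.
by rewrite -expRM_natl -[leRHS]expR0 ler_expR mulrN oppr_le0 mulr_ge0// mulr_ge0// ltW.
Qed.

(** With [c = expR (- lam h) - 1], the exponential increment minus its linear part
    is [(c + lam h) Y_s], of order [h^2], plus [Y_s] times a centred function of
    [W t - W s]. *)
Lemma geometric_motion_expands T : 0 <= T ->
  exists2 C, 0 <= C & expands P F W lam T C geometric_motion.
Proof.
move=> T0; pose g := mean P (Y0 ^+ 2) * expR T.
have g0 : 0 <= g by rewrite mulr_ge0 ?expR_ge0 ?mean_sqr_ge0.
exists (g * (lam ^+ 4 + 4 + 4 * lam ^+ 2)).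
  by rewrite mulr_ge0// !addr_ge0 ?mulr_ge0 ?exprn_ge0.
split=> [t t0 _|s t s0 st tT]; first by have [] := geometric_motion_L2_at t0.
set h := t - s => h2; have h0 : 0 < h by rewrite subr_gt0.
have [Zs Zsg] := geometric_motion_L2_at s0; have [mZ Z2] := Zs.
have {}Zsg : mean P (geometric_motion s ^+ 2) <= g.
  by apply: le_trans Zsg _; rewrite ler_wpM2l ?mean_sqr_ge0// ler_expR; lra.
have [N2 EN EN2 ENl] := noise_L2 s0 st.
rewrite -/h in EN2 ENl.
pose c := expR (- (lam * h)) - 1.
pose f (x : R) := (expR (x - h / 2) - 1 - x) + c * (expR (x - h / 2) - 1).
have fE : f \o (W t - W s) =
    (noise s t - cst 1 - (W t - W s)) + c *: (noise s t - cst 1) by [].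
have me : measurable_fun setT (fun x : R => expR (x - h / 2)).
  by apply: measurableT_comp => //; exact: measurable_funB.
have mf : measurable_fun setT f.
  apply: measurable_funD; first by apply: measurable_funB => //; exact: measurable_funB.
  by apply: measurable_funM => //; exact: measurable_funB.
have [D2 ED ED2] := increment_normal hF hW s0 (ltW st).
have c12 : (cst 1 : Om -> R) \in L2 := L2_cst P 1.
have N12 : noise s t - cst 1 \in L2 by exact: L2B.
have ND2 : noise s t - cst 1 - (W t - W s) \in L2 by exact: L2B.
have f2 : f \o (W t - W s) \in L2 by rewrite fE L2D ?L2Z.
have EN1 : mean P (noise s t - cst 1) = 0.
  by rewrite meanB ?L2_L1// EN mean_cst subrr.
have Ef : mean P (f \o (W t - W s)) = 0.
  by rewrite fE meanD ?L1Z ?L2_L1// meanZ ?L2_L1// meanB ?L2_L1// EN1 ED subrr mulr0 addr0.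
have EN12 : mean P ((noise s t - cst 1) ^+ 2) = expR h - 1.
  have -> : (noise s t - cst 1) ^+ 2 = noise s t ^+ 2 + (-2) *: noise s t + cst 1 by fring.
  rewrite meanD ?rpredD ?L1Z ?L2_sqr ?L2_L1// meanD ?L1Z ?L2_sqr ?L2_L1//.
  by rewrite meanZ ?L2_L1// EN2 EN mean_cst; ring.
(* [expR (- h) >= 1 - h] bounds the exponential from above for small [h]. *)
have e1 : expR h <= (1 - h)^-1.
  rewrite -[leLHS]invrK lef_pV2 ?posrE ?invr_gt0 ?expR_gt0//; last by lra.
  by rewrite -expRN (le_trans _ (expR_ge1Dx _)).
have e2 : (1 - h)^-1 <= 1 + h + 2 * h ^+ 2.
  rewrite -[leLHS]mul1r ler_pdivrMr; last by lra.
  have : 0 <= h ^+ 2 * (1 - 2 * h) by rewrite mulr_ge0 ?sqr_ge0//; lra.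
  move=> e; rewrite -subr_ge0; apply: le_trans e _.
  by rewrite le_eqVlt; apply/orP; left; apply/eqP; ring.
have e3 : expR h - 1 - h <= 2 * h ^+ 2 by lra.
have hh : h ^+ 2 <= h / 2 by rewrite expr2 ler_wpM2l// ltW.
have e4 : expR h - 1 <= 2 * h by lra.
have lh0 : 0 <= lam * h by rewrite mulr_ge0// ltW.
have c1 : c <= 0 by rewrite subr_le0 -[leRHS]expR0 ler_expR oppr_le0.
have c2 : - (lam * h) <= c by rewrite lerBrDl expR_ge1Dx.
have c3 : c + lam * h <= (lam * h) ^+ 2.
  have : expR (- (lam * h)) <= (1 + lam * h)^-1.
    by rewrite expRN lef_pV2 ?posrE ?expR_gt0 ?expR_ge1Dx//; lra.
  have : (1 + lam * h)^-1 <= 1 - lam * h + (lam * h) ^+ 2.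
    rewrite -[leLHS]mul1r ler_pdivrMr; last by lra.
    have : 0 <= (lam * h) ^+ 3 by rewrite exprn_ge0.
    move=> e; rewrite -subr_ge0; apply: le_trans e _.
    by rewrite le_eqVlt; apply/orP; left; apply/eqP; ring.
  rewrite /c; lra.
have [q2 Eq] := noise_factor s0 st mf f2 Zs.
exists ((c + lam * h) *: geometric_motion s), (geometric_motion s * (f \o (W t - W s))); split.
- rewrite (geometric_motion_step s t) fE -/h.
  have -> : expR (- (lam * h)) = 1 + c by rewrite /c addrC subrK.
  by fring.
- split; first exact: L2Z.
  rewrite mean_sqrZ//.
  have c4 : (c + lam * h) ^+ 2 <= lam ^+ 4 * h ^+ 3.
    apply: (@le_trans _ _ ((lam * h) ^+ 2 ^+ 2)).
      by rewrite lerXn2r// nnegrE ?sqr_ge0//; lra.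
    have h1 : h <= 1 by lra.
    have h43 : h ^+ 4 <= h ^+ 3 by rewrite [h ^+ 4]exprS ler_piMl ?exprn_ge0 ?(ltW h0).
    by rewrite -exprM exprMn; apply: ler_wpM2l; rewrite ?exprn_ge0.
  apply: (@le_trans _ _ (lam ^+ 4 * h ^+ 3 * g)).
    by apply: ler_pM => //; rewrite ?sqr_ge0 ?mean_sqr_ge0.
  rewrite mulrC mulrA ler_wpM2r ?exprn_ge0 ?(ltW h0)// ler_wpM2l// -addrA lerDl.
  by rewrite addr_ge0 ?mulr_ge0 ?sqr_ge0.
- split => //; rewrite Eq -mulrA; apply: ler_pM => //; rewrite ?mean_sqr_ge0//.
  rewrite fE; apply: le_trans (mean_sqrD_le _ _) _ => //; first exact: L2Z.
  rewrite mean_sqrZ// ENl EN12.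
  have c5 : c ^+ 2 <= lam ^+ 2 * h ^+ 2.
    by rewrite -exprMn -sqrrN lerXn2r ?nnegrE//; lra.
  have c6 : c ^+ 2 * (expR h - 1) <= lam ^+ 2 * h ^+ 2 * (2 * h).
    by apply: ler_pM => //; rewrite ?sqr_ge0// subr_ge0 -[leLHS]expR0 ler_expR ltW.
  have c7 : lam ^+ 2 * h ^+ 2 * (2 * h) <= lam ^+ 2 * h ^+ 2.
    have h21 : 2 * h <= 1 by lra.
    by apply: ler_piMr => //; apply: mulr_ge0; exact: sqr_ge0.
  have c8 : 0 <= lam ^+ 4 * h ^+ 2 by rewrite mulr_ge0 ?exprn_ge0// ltW.
  have c9 : 0 <= lam ^+ 2 * h ^+ 2 by rewrite mulr_ge0 ?sqr_ge0.
  lra.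
- exact: (noise_orthogonal s0 st mf f2 Ef Zs).
Qed.

End geometric_motion.

(** * Local expansion of solutions of the scalar equation *)

Section interval_integral.
Context {R : realType}.
Local Notation mu := (@lebesgue_measure R).
Implicit Types (f : R -> R) (s t : R).

Lemma continuous_integrable f s t : continuous f ->
  mu.-integrable `]s, t] (EFin \o f).
Proof.
move=> cf; apply: (@integrableS _ (measurableTypeR R) R mu `[s, t]%classic `]s, t]%classic) => //.
  exact: subset_itv_oc_cc.
apply: continuous_compact_integrable; first exact: segment_compact.
exact: continuous_subspaceT.
Qed.

Lemma measure_itv_oc s t : s <= t -> mu `]s, t] = (t - s)%:E.
Proof.
move=> st; rewrite lebesgue_measure_itv/= lte_fin; case: ltP => // ts.
by rewrite (le_anti (introT andP (conj st ts))) subrr.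
Qed.

Lemma Rintegral_itv_cst s t c : s <= t -> (\int[mu]_(r in `]s, t]) c = c * (t - s))%R.
Proof.
move=> st; have -> : t - s = fine (mu `]s, t]) by rewrite measure_itv_oc.
exact: Rintegral_cst.
Qed.

(** The integral of the square of [f] minus its average is nonnegative. *)
Lemma Rintegral_sqr_le f s t : s < t -> continuous f ->
  (\int[mu]_(r in `]s, t]) f r) ^+ 2 <=
  (t - s) * \int[mu]_(r in `]s, t]) (f r ^+ 2) :> R.
Proof.
move=> st cf; set h := t - s; have h0 : 0 < h by rewrite subr_gt0.
pose c := (\int[mu]_(r in `]s, t]) f r)%R / h.
have if1 := continuous_integrable s t cf.
have cf2 : continuous (fun r => f r ^+ 2).
  by move=> r; exact: (continuousM (cf r) (cf r)).
have if2 := continuous_integrable s t cf2.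
have cfc : continuous (fun r => -2 * c * f r).
  by move=> r; exact: (continuousM (@cst_continuous _ _ (-2 * c) r) (cf r)).
have ifc := continuous_integrable s t cfc.
have icc : mu.-integrable `]s, t] (EFin \o cst (c ^+ 2)).
  by apply: continuous_integrable => r; exact: cst_continuous.
have : 0 <= (\int[mu]_(r in `]s, t]) ((f r - c) ^+ 2))%R.
  by apply: Rintegral_ge0 => r _; rewrite sqr_ge0.
have -> : (\int[mu]_(r in `]s, t]) ((f r - c) ^+ 2) =
    \int[mu]_(r in `]s, t]) (f r ^+ 2 + (-2 * c * f r + c ^+ 2)))%R.
  by apply: eq_Rintegral => r _; ring.
have ifcc : mu.-integrable `]s, t] (EFin \o (fun r => -2 * c * f r + c ^+ 2)).
  apply: continuous_integrable => r.
  exact: (continuousD (cfc r) (@cst_continuous _ _ (c ^+ 2) r)).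
rewrite RintegralD// RintegralD// RintegralZl// Rintegral_itv_cst ?(ltW st)// -/h.
have -> : (\int[mu]_(r in `]s, t]) f r)%R = c * h by rewrite /c divfK ?gt_eqF.
move=> H; rewrite -subr_ge0; apply: le_trans (mulr_ge0 (ltW h0) H) _;
   rewrite le_eqVlt; apply/orP; left; apply/eqP; ring.
Qed.

End interval_integral.

Section scalar_equation.
Context {R : realType} {d : measure_display} {Om : measurableType d}.
Variables (P : probability Om R) (F : R -> set (set Om)) (W : R -> Om -> R).
Hypotheses (hF : usual_conditions P F) (hW : brownian_motion P F W).
Local Notation L2 := (Lfun P 2%:E).
Local Notation mu := (@lebesgue_measure R).
Variables (lam : R) (X I : R -> Om -> R).
Hypotheses (lam0 : 0 <= lam) (cX : forall w, continuous (X ^~ w)).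
Hypothesis mX : forall t, measurable_fun setT (X t).
Hypothesis aX : forall t, 0 <= t -> measurable_wrt (F t) (X t).
Hypothesis bX : forall T, exists m : R,
  forall t, 0 <= t -> t <= T -> (\int[P]_w (X t w ^+ 2)%:E <= m%:E)%E.
Hypothesis XI : scalar_ito P F W X I.
Hypothesis eqX : forall w t, 0 <= t ->
  X t w = X 0 w - lam * (\int[mu]_(r in `]0%R, t]) X r w)%R + I t w.

Let jX : measurable_fun setT (fun z : Om * measurableTypeR R => X z.2 z.1).
Proof. exact: continuous_paths_measurable. Qed.

Lemma scalar_L2_at t : 0 <= t -> L2_at P F t (X t).
Proof.
move=> t0; split; first exact: aX.
have [m Xm] := bX t; apply: L2P; first exact: mX.
by apply: le_lt_trans (Xm t t0 (lexx t)) _; rewrite ltry.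
Qed.

(** The given bound may be negative, when no time satisfies the constraints. *)
Lemma scalar_bound T : exists2 m, 0 <= m &
  forall t, 0 <= t -> t <= T -> mean P (X t ^+ 2) <= m.
Proof.
have [m Xm] := bX T; exists (Num.max m 0); first by rewrite le_max lexx orbT.
move=> t t0 tT; have [_ X2] := scalar_L2_at t0.
by rewrite le_max -lee_fin -integral_sqr// Xm.
Qed.

Lemma scalar_equation s t w : 0 <= s -> s <= t ->
  X t w - X s w = - (lam * (\int[mu]_(r in `]s, t]) X r w)%R) + (I t w - I s w).
Proof.
move=> s0 st; rewrite (eqX w (le_trans s0 st)) (eqX w s0).
have -> : (\int[mu]_(r in `]0%R, t]) X r w =
    \int[mu]_(r in `]0%R, s]) X r w + \int[mu]_(r in `]s, t]) X r w)%R.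
  rewrite -Rintegral_setU//.
  - by rewrite -itv_bndbnd_setU// bnd_simp.
  - by rewrite -itv_bndbnd_setU ?bnd_simp//; exact: continuous_integrable.
  - apply/disj_setPLR => r /=; rewrite !in_itv/= => /andP[_ rs].
    by apply/negP; rewrite negb_and -leNgt rs.
ring.
Qed.

Lemma mean_square_integral_le s t (x : Om -> R) m : s <= t -> measurable_fun setT x ->
  (forall r, s < r -> r <= t -> (\int[P]_w ((X r w - x w) ^+ 2)%:E <= m%:E)%E) ->
  (\int[P]_w \int[mu]_(r in `]s, t]) ((X r w - x w) ^+ 2)%:E <= (m * (t - s))%:E)%E.
Proof.
move=> st mx H.
pose f (z : Om * measurableTypeR R) := ((X z.2 z.1 - x z.1) ^+ 2)%:E.
have mf : measurable_fun setT f.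
  apply/measurable_EFinP; apply: measurable_funX; apply: measurable_funB => //.
  exact: measurableT_comp mx measurable_fst.
have f0 z : (0 <= f z)%E by rewrite lee_fin sqr_ge0.
rewrite (integral_exchange P (D := `]s, t]) (f := f))//.
apply: (@le_trans _ _ (\int[mu]_(r in `]s, t]) m%:E)%E).
  apply: ge0_le_integral => //.
  - by move=> r _; apply: integral_ge0 => w _; exact: (f0 (w, r)).
  - apply: measurable_funTS.
    exact: (measurable_fun_fubini_tonelli_G f).
  - by move=> r; rewrite /= in_itv/= => /andP[sr rt]; exact: H.
by rewrite EFinM -measure_itv_oc// integral_cst.
Qed.

(** By the equation, the variable on the left is [- lam] times the integral of
    [X_r - x] over [(s, t]], so the Cauchy-Schwarz inequality in time applies. Written
    in this way, it is visibly measurable. *)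
Lemma drift_sqr_le s t (x : Om -> R) m : 0 <= s -> s < t -> L2_at P F s x ->
  (forall r, s < r -> r <= t -> mean P ((X r - x) ^+ 2) <= m) ->
  X t - X s - (I t - I s) + (lam * (t - s)) *: x \in L2 /\
  mean P ((X t - X s - (I t - I s) + (lam * (t - s)) *: x) ^+ 2) <=
    lam ^+ 2 * m * (t - s) ^+ 2.
Proof.
move=> s0 st [_ x2] H; set p := X t - _ - _ + _.
have [t0 h0] : 0 <= t /\ 0 < t - s by rewrite subr_gt0 (ltW (le_lt_trans s0 st)).
have X2 r : 0 <= r -> X r \in L2 by move=> r0; have [] := scalar_L2_at r0.
have I2 r : 0 <= r -> I r \in L2.
  by move=> r0; have [] := scalar_ito_L2 hF hW XI r0.
have p2 : p \in L2 by rewrite /p L2D ?L2Z// !L2B ?X2 ?I2.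
split => //; rewrite -lee_fin -integral_sqr//.
have pE w : p w = - lam * (\int[mu]_(r in `]s, t]) (X r w - x w))%R.
  rewrite RintegralB//; last 2 first.
    exact: continuous_integrable.
    by apply: continuous_integrable => r; exact: cst_continuous.
  rewrite Rintegral_itv_cst ?(ltW st)//.
  rewrite -[LHS]/(X t w - X s w - (I t w - I s w) + lam * (t - s) * x w).
  rewrite (scalar_equation w s0 (ltW st)); ring.
have c2 w : continuous (fun r => (X r w - x w) ^+ 2).
  have cd : continuous (fun r => X r w - x w).
    by move=> r; apply: cvgB; [exact: cX|exact: cvg_cst].
  by move=> r; exact: (continuousM (cd r) (cd r)).
have mx : measurable_fun setT x := L2_measurable x2.
pose f (z : Om * measurableTypeR R) := ((X z.2 z.1 - x z.1) ^+ 2)%:E.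
have mf : measurable_fun setT f.
  apply/measurable_EFinP; apply: measurable_funX; apply: measurable_funB => //.
  exact: measurableT_comp mx measurable_fst.
have f0 z : (0 <= f z)%E by rewrite lee_fin sqr_ge0.
have mf' := measurable_inner_integral (measurable_itv `]s, t]) mf f0.
apply: (@le_trans _ _ (\int[P]_w ((lam ^+ 2 * (t - s))%:E *
    \int[mu]_(r in `]s, t]) ((X r w - x w) ^+ 2)%:E))%E).
  apply: ge0_le_integral => //.
  - by move=> w _; rewrite lee_fin sqr_ge0.
  - by apply/measurable_EFinP; apply: measurable_funX; exact: L2_measurable p2.
  - by apply: emeasurable_funM.
  - move=> w _; have intc := continuous_integrable s t (c2 w).
    rewrite -[X in (_ * X)%E]fineK ?integrable_fin_num//.
    rewrite -EFinM lee_fin pE exprMn sqrrN. rewrite -[leRHS]mulrA ler_wpM2l ?sqr_ge0//.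
    apply: Rintegral_sqr_le => // r.
    by apply: cvgB; [exact: cX|exact: cvg_cst].
rewrite ge0_integralZl_EFin//; last 2 first.
- by move=> w _; apply: integral_ge0 => r _; exact: (f0 (w, r)).
- by rewrite mulr_ge0 ?sqr_ge0// ltW.
have -> : lam ^+ 2 * m * (t - s) ^+ 2 = lam ^+ 2 * (t - s) * (m * (t - s)) by ring.
rewrite [leRHS]EFinM; apply: lee_wpmul2l; first by rewrite lee_fin mulr_ge0 ?sqr_ge0// ltW.
apply: (mean_square_integral_le (ltW st) mx) => r sr rt.
have D2 : X r - x \in L2 by apply: L2B => //; apply: X2; rewrite (le_trans s0)// ltW.
by have := integral_sqr D2 => ->; rewrite lee_fin H.
Qed.

(** Applied with [x = 0], the estimates on the drift and on the stochastic integral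
    show that [E (X_t - X_s)^2 = O(h)]. Applied again with [x = X_s], they gain a factor
    [h] from this, which gives the two remainders. *)
Lemma scalar_expands T : 0 <= T -> exists2 C, 0 <= C & expands P F W lam T C X.
Proof.
move=> T0; have [m m0 Xm] := scalar_bound T.
have X2 r : 0 <= r -> X r \in L2 by move=> r0; have [] := scalar_L2_at r0.
have I2 r : 0 <= r -> I r \in L2.
  by move=> r0; have [] := scalar_ito_L2 hF hW XI r0.
pose L := (2 * lam ^+ 2 + 8) * m.
have L0 : 0 <= L by rewrite mulr_ge0// addr_ge0// mulr_ge0// sqr_ge0.
(* First pass, with [x = 0]: the increments of [X] are of order [h] in mean square. *)
have reg s t : 0 <= s -> s < t -> t <= T -> t - s <= 2^-1 ->
    mean P ((X t - X s) ^+ 2) <= L * (t - s).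
  move=> s0 st tT; set h := t - s => h2; have h0 : 0 < h by rewrite subr_gt0.
  have t0 : 0 <= t by rewrite (le_trans s0)// ltW.
  have z2 := L2_at_cst P F s 0.
  have Hm r : s < r -> r <= t -> mean P ((X r - cst 0) ^+ 2) <= m.
    move=> sr rt; rewrite subr0; apply: Xm; last exact: le_trans tT.
    by rewrite (le_trans s0)// ltW.
  have [] := drift_sqr_le s0 st z2 Hm; rewrite (_ : _ *: cst 0 = 0); last first.
    by apply/funext => w; rewrite /= scaler0.
  rewrite addr0 -/h => D2 Dm.
  have Hi : (\int[P]_w \int[mu]_(r in `]s, t]) ((X r w - cst 0 w) ^+ 2)%:E <= (m * h)%:E)%E.
    apply: mean_square_integral_le; [exact: ltW|exact: measurable_cst|].
    move=> r sr rt; have r0 : 0 <= r by rewrite (le_trans s0)// ltW.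
    have D' : X r - cst 0 \in L2 by rewrite L2B ?X2// L2_cst.
    by have := integral_sqr D' => ->; rewrite lee_fin Hm.
  have := ito_increment_sqr hF hW jX XI s0 (ltW st) z2 Hi.
  rewrite (_ : cst 0 * _ = 0) ?subr0; last by apply/funext => w; rewrite !fctE mul0r.
  move=> Im.
  rewrite (_ : X t - X s = (X t - X s - (I t - I s)) + (I t - I s)); last by fring.
  apply: le_trans (mean_sqrD_le _ _) _ => //; first by rewrite L2B ?I2.
  have : lam ^+ 2 * m * h ^+ 2 <= lam ^+ 2 * m * h.
    by rewrite ler_wpM2l ?mulr_ge0 ?sqr_ge0// expr2 ler_piMl ?(ltW h0)//; lra.
  rewrite /L; lra.
exists (lam ^+ 2 * L + 4 * L); first by rewrite addr_ge0// mulr_ge0// sqr_ge0.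
split=> [t t0 _|s t s0 st tT]; first exact: scalar_L2_at.
set h := t - s => h2; have h0 : 0 < h by rewrite subr_gt0.
have t0 : 0 <= t by rewrite (le_trans s0)// ltW.
have Xs := scalar_L2_at s0; have [_ Xs2] := Xs.
have Hm r : s < r -> r <= t -> mean P ((X r - X s) ^+ 2) <= L * h.
  move=> sr rt; have rh : r - s <= h by rewrite lerB.
  apply: le_trans (reg s r s0 sr (le_trans rt tT) (le_trans rh h2)) _.
  by rewrite ler_wpM2l.
have [p2 Pm] := drift_sqr_le s0 st Xs Hm.
have Hi : (\int[P]_w \int[mu]_(r in `]s, t]) ((X r w - X s w) ^+ 2)%:E <=
    (L * h * h)%:E)%E.
  apply: mean_square_integral_le; [exact: ltW|exact: mX|].
  move=> r sr rt; have r0 : 0 <= r by rewrite (le_trans s0)// ltW.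
  have D' : X r - X s \in L2 by rewrite L2B ?X2.
  by have := integral_sqr D' => ->; rewrite lee_fin Hm.
have Im := ito_increment_sqr hF hW jX XI s0 (ltW st) Xs Hi.
have [_ q2] := ito_increment_L2_at hF hW XI s0 (ltW st) Xs.
exists (X t - X s - (I t - I s) + (lam * h) *: X s), (I t - I s - X s * (W t - W s)).
split.
- by fring.
- split => //; apply: le_trans Pm _.
  have : 0 <= 4 * L * h ^+ 3 by rewrite mulr_ge0 ?exprn_ge0 ?(ltW h0)// mulr_ge0.
  move=> e; rewrite -/h -subr_ge0; apply: le_trans e _.
  by rewrite le_eqVlt; apply/orP; left; apply/eqP; ring.
- split => //; apply: le_trans Im _.
  have : 0 <= lam ^+ 2 * L * h ^+ 2 by rewrite mulr_ge0 ?sqr_ge0// mulr_ge0 ?sqr_ge0.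
  move=> e; rewrite -subr_ge0; apply: le_trans e _.
  by rewrite le_eqVlt; apply/orP; left; apply/eqP; ring.
- by move=> y ys; exact: (ito_increment_orthogonal hF hW jX XI s0 (ltW st) Xs Hi ys).
Qed.

End scalar_equation.

(** * Growth of Brownian paths *)

Section maximal.
Context {R : realType} {d : measure_display} {Om : measurableType d}.
Variables (P : probability Om R) (F : R -> set (set Om)) (W : R -> Om -> R).
Hypotheses (hF : usual_conditions P F) (hW : brownian_motion P F W).
Local Notation L2 := (Lfun P 2%:E).

Section stopped.
Variables (h a : R).
Hypotheses (h0 : 0 <= h) (a0 : 0 < a).
Let tm (i : nat) : R := i%:R * h.

(** The walk [i |-> W (i h) - W 0], frozen once it has left the interval
    [(-a, a)]. *)
Fixpoint stopped (i : nat) : Om -> R := if i is j.+1 then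
  stopped j + (\1_[set x : R | `|x| < a] \o stopped j) * (W (tm j.+1) - W (tm j))
  else cst 0.

Let tm0 i : 0 <= tm i. Proof. exact: mulr_ge0. Qed.

Let tmS i : tm i <= tm i.+1. Proof. by rewrite ler_wpM2r// ler_nat. Qed.

Let measurable_ball0 : measurable_fun setT (\1_[set x : R | `|x| < a] : R -> R).
Proof.
apply: measurable_indic.
rewrite (_ : [set x | _] = `]- a, a[%classic).
  exact: measurable_itv.
by apply/seteqP; split => x /=; rewrite in_itv/= ltr_norml.
Qed.

(** Freezing multiplies each increment by an indicator known at its start, so the
    increments stay orthogonal and their variances do not increase. *)
Lemma stopped_sqr i : L2_at P F (tm i) (stopped i) /\
  mean P (stopped i ^+ 2) <= tm i.
Proof.
elim: i => [|i [Qi Ei]] /=.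
  split; first exact: L2_at_cst.
  by rewrite (_ : cst 0 ^+ 2 = cst 0) ?mean_cst ?tm0//; fring.
have [mQ Q2] := Qi.
set v := \1_[set x : R | `|x| < a] \o stopped i.
have vi : L2_at P F (tm i) v.
  have mv : measurable_wrt (F (tm i)) v by exact: measurableT_comp measurable_ball0 mQ.
  have mv' : measurable_fun setT v.
    exact: measurable_wrt_measurable (filtration_sigma hF (tm0 i))
      (filtration_measurable hF (tm0 i)) mv.
  split => //; apply: L2P => //.
  apply: (@le_lt_trans _ _ (\int[P]_w (1%:E))%E).
    apply: ge0_le_integral => //.
    - by move=> w _; rewrite lee_fin sqr_ge0.
    - by apply/measurable_EFinP; exact: measurable_funX.
    - by move=> w _; rewrite lee_fin /v /= indicE; case: (_ \in _); rewrite ?expr1n ?expr0n.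
  by rewrite integral_cst//= probability_setT mule1 ltry.
have [vD EvD] := mul_increment_L2 hF hW (tm0 i) (tmS i) vi.
have [mv v2] := vi; have [_ vD2] := vD.
have Qi' := L2_at_le hF (tm0 i) (tmS i) Qi.
split; first exact: L2_atD.
rewrite mean_sqrD// mulrA.
have mQv : measurable_wrt (F (tm i)) (stopped i * v) by exact: measurable_funM.
have [_ ->] := mean_mul_increment hF hW (tm0 i) (tmS i) mQv (L2M Q2 v2).
rewrite mulr0 addr0 EvD.
have v1 : mean P (v ^+ 2) <= 1.
  rewrite -[leRHS](mean_cst P 1); apply: mean_le; first exact: L2_sqr.
    exact/L2_L1/L2_cst.
  by move=> w; rewrite exprfctE /v /= indicE; case: (_ \in _); rewrite ?expr1n ?expr0n.
have : mean P (v ^+ 2) * (tm i.+1 - tm i) <= tm i.+1 - tm i.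
  by rewrite ler_piMl// subr_ge0.
lra.
Qed.

(** A walk that is inside at the end was never frozen, so it coincides with the
    original one. *)
Lemma stopped_exit n w : `|stopped n w| < a -> forall i, (i <= n)%N ->
  `|W (tm i) w - W 0 w| < a.
Proof.
have stepE i : stopped i.+1 w = stopped i w +
    (`|stopped i w| < a)%R%:R * (W (tm i.+1) w - W (tm i) w).
  rewrite /= -[LHS]/(stopped i w + \1_[set x : R | `|x| < a] (stopped i w) *
     (W (tm i.+1) w - W (tm i) w)) indicE; congr (_ + (nat_of_bool _)%:R * _).
  by apply/idP/idP => [/set_mem//|?]; exact: mem_set.
have back i : `|stopped i.+1 w| < a -> `|stopped i w| < a.
  by rewrite stepE; case: (boolP (`|stopped i w| < a)) => // /negbTE si; rewrite mul0r addr0 si.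
have all_lt k i : `|stopped (k + i) w| < a -> `|stopped i w| < a.
  by elim: k => // k IH; rewrite addSn => /back.
have eqS i : `|stopped i w| < a -> stopped i w = W (tm i) w - W 0 w.
  elim: i => [_|i IH si]; first by rewrite /= /tm mul0r subrr.
  by rewrite stepE (back _ si) mul1r (IH (back _ si)) addrC addrA subrK.
move=> sn i iN; have si : `|stopped i w| < a.
  by apply: (all_lt (n - i)%N); rewrite subnK.
by rewrite -eqS.
Qed.

Lemma stopped_chebyshev n :
  measurable [set w | a <= `|stopped n w|] /\
  (P [set w | (a <= `|stopped n w|)%R] <= (tm n / a ^+ 2)%:E)%E.
Proof.
have [[mQ Q2] E2] := stopped_sqr n; set A := [set w | _].
have mA : measurable A.
  have -> : A = setT `&` (fun w => `|stopped n w|) @^-1` `[a, +oo[.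
    by rewrite setTI; apply/seteqP; split => w /=; rewrite in_itv/= andbT.
  have mn : measurable_fun setT (fun w => `|stopped n w|).
    exact: measurableT_comp (@normr_measurable R setT) (L2_measurable Q2).
  by apply: mn => //; exact: measurable_itv.
split => //; rewrite -expectation_indic//.
have A2 : (\1_A : Om -> R) \in Lfun P 1%E.
  by apply/Lfun1_integrable; exact: integrable_indic.
rewrite -meanE// lee_fin ler_pdivlMr ?exprn_gt0//.
apply: le_trans E2; rewrite mulrC -meanZ//; apply: mean_le.
- exact: L1Z.
- exact: L2_sqr.
- move=> w; rewrite -[leLHS]/(a ^+ 2 * \1_A w) exprfctE indicE.
  case: (boolP (w \in A)) => [/set_mem|_]; last by rewrite mulr0 sqr_ge0.
  rewrite /A /= mulr1 -(real_normK (num_real (stopped n w))) => aw.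
  by rewrite lerXn2r ?nnegrE// ltW.
Qed.

End stopped.

(** [A] is the event that from some [n] on the walk of step [T / n.+1] leaves
    [(-a, a)]; it is an increasing union of events of probability at most [T / a ^+ 2].
    A continuous path that exceeds [a] somewhere does so on an interval, which every
    fine enough grid meets. *)
Lemma maximal_inequality (T a : R) : 0 < T -> 0 < a -> exists A : set Om,
  [/\ measurable A, (P A <= (T / a ^+ 2)%:E)%E
    & forall w, {within `[0, +oo[, continuous (W ^~ w)} -> ~ A w ->
      forall t, 0 <= t -> t <= T -> `|W t w - W 0 w| <= a].
Proof.
move=> T0 a0; pose h n : R := T / n.+1%:R.
have h0 n : 0 < h n by rewrite divr_gt0.
pose B n := [set w | a <= `|stopped (h n) a n.+1 w|].
have mB n : measurable (B n) by have [] := stopped_chebyshev (ltW (h0 n)) a0 n.+1.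
have PB n : (P (B n) <= (T / a ^+ 2)%:E)%E.
  have [_] := stopped_chebyshev (ltW (h0 n)) a0 n.+1.
  by rewrite /h mulrCA mulfV ?mulr1// pnatr_eq0.
pose C N := \bigcap_(n in [set n | (N <= n)%N]) B n.
have mC N : measurable (C N) by apply: bigcap_measurable => //; exists N => /=.
exists (\bigcup_N C N); split.
- exact: bigcup_measurable.
- have cvC : P (C N) @[N --> \oo] --> P (\bigcup_N C N).
    apply: nondecreasing_cvg_mu => //; first exact: bigcup_measurable.
    move=> N M NM; apply/subsetPset => w CN n /= Mn; apply: CN => /=.
    exact: leq_trans Mn.
  have -> : P (\bigcup_N C N) = limn (P \o C) by apply/esym/cvg_lim.
  apply: lime_le; first by apply/cvg_ex; exists (P (\bigcup_N C N)).
  apply: nearW => N; apply: le_trans (PB N); apply: le_measure; rewrite ?inE//.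
  by move=> w; apply; rewrite /=.
- move=> w cw nA t t_ge0 tT; rewrite leNgt; apply/negP => at_.
  have ct : (fun r => `|W r w - W 0 w|) @ within `[0, +oo[%classic (nbhs t) -->
      `|W t w - W 0 w|.
    apply: cvg_norm; apply: cvgB; last exact: cvg_cst.
    by move/subspace_continuousP: cw; apply; rewrite /= in_itv/= t_ge0.
  have := cvgr_gt _ ct a at_; rewrite near_withinE => -[e /= e0 He].
  have [N hN] : exists N, h N < e.
    exists (Num.bound (T / e)); rewrite /h ltr_pdivrMr// mulrC -ltr_pdivrMr//.
    apply: lt_trans (_ : (Num.bound (T / e))%:R < _); last by rewrite ltr_nat.
    by apply: archi_boundP; rewrite divr_ge0// ltW.
  (* The path lies in no [C N], so some arbitrarily fine walk stays inside. *)
  have [n Nn nB] : exists2 n, (N <= n)%N & ~ B n w.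
    apply: contrapT => H; apply: nA; exists N => // n /= Nn.
    by apply: contrapT => nB; apply: H; exists n.
  have hn : h n < e.
    by apply: le_lt_trans hN; rewrite /h ler_wpM2l ?(ltW T0)// lef_pV2 ?posrE ?ltr0n// ler_nat.
  have {}nB : `|stopped (h n) a n.+1 w| < a by rewrite ltNge; apply/negP.
  pose i := Num.truncn (t / h n).
  have ti0 : 0 <= t / h n by rewrite divr_ge0// ltW.
  have /andP[i1 i2] := truncn_itv ti0.
  have iN : (i <= n.+1)%N.
    rewrite -(ler_nat R); apply: le_trans i1 _.
    by rewrite ler_pdivrMr ?h0// /h mulrCA mulfV ?mulr1 ?pnatr_eq0.
  have := stopped_exit nB iN; rewrite ltNge => /negP; apply; apply: ltW; apply: He.
    rewrite /ball/= ger0_norm; last by rewrite subr_ge0 -ler_pdivlMr ?h0.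
    apply: le_lt_trans hn; rewrite lerBlDr (_ : _ + _ = i.+1%:R * h n); last first.
      by rewrite -natr1 mulrDl mul1r addrC.
    by rewrite -ler_pdivrMr ?h0// ltW.
  by rewrite /= in_itv/= andbT mulr_ge0// ltW.
Qed.

(** Apply the maximal inequality up to time [16 ^+ j.+1] with the bound [8 ^+ j]:
    the probabilities [16 / 4 ^+ j] are summable, and [8 ^+ j] is negligible compared
    with the times beyond [16 ^+ j]. *)
Lemma brownian_growth :
  {ae P, forall w, (W t w - W 0 w) / t @[t --> +oo] --> (0 : R)}.
Proof.
have T0 j : 0 < 16 ^+ j.+1 :> R by rewrite exprn_gt0.
have a0 j : 0 < 8 ^+ j :> R by rewrite exprn_gt0.
have /choice[A HA] : forall j, exists A : set Om,
  [/\ measurable A, (P A <= (16 ^+ j.+1 / (8 ^+ j) ^+ 2)%:E)%E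
    & forall w, {within `[0, +oo[, continuous (W ^~ w)} -> ~ A w ->
      forall t, 0 <= t -> t <= 16 ^+ j.+1 -> `|W t w - W 0 w| <= 8 ^+ j].
  by move=> j; exact: maximal_inequality.
have mA j : measurable (A j) by have [] := HA j.
have null : P (lim_sup_set A) = 0%E.
  apply: lim_sup_set_cvg0 => //.
  apply: (@le_lt_trans _ _ (\sum_(j <oo) (32 / (2 ^ j.+1)%:R)%:E)%E).
    apply: lee_nneseries => // j _; have [_ + _] := HA j => /le_trans; apply.
    rewrite lee_fin natrX.
    have -> : 16 ^+ j.+1 / (8 ^+ j) ^+ 2 = 16 * (4 ^+ j)^-1 :> R.
      rewrite -exprM mulnC exprM exprS -mulrA -expr_div_n.
      by congr (_ * _); rewrite -exprVn; congr (_ ^+ _); lra.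
    have -> : 32 / 2 ^+ j.+1 = 16 * (2 ^+ j)^-1 :> R.
      by rewrite exprS invfM mulrA; congr (_ * _); lra.
    by rewrite ler_pM2l// lef_pV2 ?posrE ?exprn_gt0// lerXn2r// ?nnegrE//; lra.
  by apply: le_lt_trans (epsilon_trick0 xpredT _) _; rewrite ?lee_fin ?ltry.
case: hW => _ cW _ _ _.
have : {ae P, forall w, ~ lim_sup_set A w}.
  exists (lim_sup_set A); split => //.
    apply: bigcap_measurable; first by exists 0.
    by move=> n _; apply: bigcup_measurable.
  by move=> w /= /contrapT.
apply: filterS2 cW => w cw; rewrite /lim_sup_set => nA.
have [N HN] : exists N, forall j, (N <= j)%N -> ~ A j w.
  apply: contrapT => H; apply: nA => n _; apply: contrapT => Hn; apply: H.
  by exists n => j nj Aj; apply: Hn; exists j.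
have key j t : (N <= j)%N -> 16 ^+ j <= t -> t <= 16 ^+ j.+1 ->
    `|(W t w - W 0 w) / t| <= (2 ^+ j)^-1.
  move=> Nj jt tj; have t0 : 0 < t by apply: lt_le_trans jt; rewrite exprn_gt0.
  have [_ _ /(_ w cw (HN j Nj) t (ltW t0) tj) Hw] := HA j.
  rewrite normrM [`|t^-1|]gtr0_norm ?invr_gt0// ler_pdivrMr//.
  apply: le_trans Hw _; rewrite mulrC ler_pdivlMr ?exprn_gt0//.
  by apply: le_trans jt; rewrite -exprMn le_eqVlt; apply/orP; left; apply/eqP; congr (_ ^+ _); ring.
apply/cvgrPdist_le => e e0.
have [M HM] : exists M, forall j, (M <= j)%N -> (2 ^+ j)^-1 <= e :> R.
  exists (Num.bound e^-1) => j Mj; rewrite -[leRHS]invrK lef_pV2 ?posrE ?exprn_gt0 ?invr_gt0//.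
  apply: le_trans (ltW (archi_boundP (ltW _))) _; first by rewrite invr_gt0.
  by rewrite -natrX ler_nat (leq_trans Mj)// ltnW// ltn_expl.
near=> t.
have t1 : 16 ^+ (maxn N M).+1 <= t by near: t; exact: nbhs_pinfty_ge.
have t0 : 0 < t by apply: lt_le_trans t1; rewrite exprn_gt0.
pose j := trunc_log 16 (Num.truncn t).
have tn1 : (1 <= Num.truncn t)%N.
  rewrite truncn_gt0; apply: le_trans t1; rewrite exprn_ege1//; lra.
have /andP[jt tj] := trunc_log_bounds (isT : (1 < 16)%N) tn1.
have {}jt : 16 ^+ j <= t by rewrite -natrX -truncn_ge_nat// ltW.
have {}tj : t < 16 ^+ j.+1 by rewrite -natrX -truncn_lt_nat// ltW.
have NMj : (maxn N M <= j)%N.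
  have : (16 ^ (maxn N M).+1)%:R < (16 ^ j.+1)%:R :> R.
    by rewrite !natrX; exact: le_lt_trans t1 tj.
  by rewrite ltr_nat ltn_exp2l// ltnS => /ltnW.
move: NMj; rewrite geq_max => /andP[Nj Mj].
rewrite sub0r normrN; apply: le_trans (key j t Nj jt (ltW tj)) _.
exact: HM.
Unshelve. all: by end_near. Qed.

End maximal.

(** * Coordinates of series *)

Section lower_integral.
Context d (T : measurableType d) (R : realType).
Variable mu : {measure set T -> \bar R}.
Local Open Scope ereal_scope.

(** The integral of a nonnegative function is a supremum over the simple functions
    below it, hence is monotone without any measurability. This matters because
    norms of series need not be measurable functions of the path. *)
Lemma ge0_le_lower_integral (D : set T) (f g : T -> \bar R) :
  (forall x, D x -> 0 <= f x) -> (forall x, D x -> f x <= g x) ->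
  \int[mu]_(x in D) f x <= \int[mu]_(x in D) g x.
Proof.
move=> f0 fg; rewrite integral_mkcond [leRHS]integral_mkcond.
have f0' x : 0 <= (f \_ D) x.
  by rewrite patchE; case: ifPn => // /set_mem/f0.
have fg' x : (f \_ D) x <= (g \_ D) x.
  by rewrite !patchE; case: ifPn => // /set_mem/fg.
rewrite !ge0_integralTE//; last by move=> x; exact: le_trans (fg' x).
apply: le_ereal_sup => _ [h hf <-]; exists h => //= x.
exact: le_trans (hf x) (fg' x).
Qed.

End lower_integral.

Section coordinates.
Context {R : realType}.
Implicit Types (g : R) (v : fseries R) (k : nat).

Definition weight g k : R := Num.sqrt ((1 + k%:R ^+ 2) `^ g).

Lemma weight_gt0 g k : 0 < weight g k.
Proof. by rewrite sqrtr_gt0 powR_gt0// ltr_pwDl// sqr_ge0. Qed.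

(** One term of a series of nonnegative terms. *)
Lemma coordinate_sqr_le g v k : (1 <= k)%N ->
  (((weight g k * v k) ^+ 2)%:E <= Hnorm2 g v)%E.
Proof.
move=> k1; rewrite exprMn sqr_sqrtr ?powR_ge0//.
have t0 i : (0 <= ((1 + i%:R ^+ 2) `^ g * v i ^+ 2)%:E)%E.
  by rewrite lee_fin mulr_ge0 ?powR_ge0 ?sqr_ge0.
apply: le_trans (nneseries_lim_ge k.+1 (fun i _ _ => t0 i)).
rewrite big_nat_recr//= leeDr// sume_ge0// => i _; exact: t0.
Qed.

Lemma coordinate_le g v k : (1 <= k)%N ->
  (`|weight g k * v k|%:E <= Hnorm g v)%E.
Proof.
move=> k1; rewrite /Hnorm.
have -> : `|weight g k * v k|%:E = sqrte ((weight g k * v k) ^+ 2)%:E.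
  by rewrite /= sqrtr_sqr.
rewrite lee_sqrt; first exact: coordinate_sqr_le.
by apply: le_trans (coordinate_sqr_le g v k1); rewrite lee_fin sqr_ge0.
Qed.

Lemma Hopen_coordinate g k (a : R) : (1 <= k)%N ->
  Hopen g [set v : fseries R | a < v k].
Proof.
move=> k1 v vg /= av; exists (weight g k * (v k - a)).
  by rewrite mulr_gt0 ?weight_gt0 ?subr_gt0.
move=> w wg h; have := le_lt_trans (coordinate_le g _ k1) h.
rewrite lte_fin normrM gtr0_norm ?weight_gt0// ltr_pM2l ?weight_gt0//.
by rewrite /Hsub ltr_norml => /andP[+ _]; lra.
Qed.

(** The half-spaces defined by a coordinate are open for the norm. *)
Lemma Hmeasurable_coordinate (d : measure_display) (Om : measurableType d)
    (G : set (set Om)) g (X : Om -> fseries R) k : (1 <= k)%N ->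
  sigma_algebra setT G -> Hmeasurable G g X -> measurable_wrt G (fun w => X w k).
Proof.
move=> k1 sG [_ mX].
apply: (measurability _ (RGenOInfty.measurableE R)) => _ [_ [a ->] <-].
rewrite setTI /measurable/= (sigma_algebra_id sG).
have -> : (fun w => X w k) @^-1` `]a, +oo[ = X @^-1` [set v : fseries R | a < v k].
  by apply/seteqP; split => w /=; rewrite in_itv/= andbT.
exact/mX/Hopen_coordinate.
Qed.

(** The truncation of negative times makes the path continuous on the whole line. *)
Lemma Hcontinuous_coordinate g (p : R -> fseries R) k : (1 <= k)%N ->
  Hcontinuous g p -> continuous (fun r : R => p (Num.max r 0) k).
Proof.
move=> k1 cp r; set t := Num.max r 0.
have t0 : 0 <= t by rewrite le_max lexx orbT.
have [_ Ht] := cp t t0.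
have cm : (Num.max x 0) @[x --> r] --> t.
  have := @continuous_max R R (fun x : R => x : R^o) (fun=> (0 : R^o)) r.
  by apply; [exact: cvg_id|exact: cvg_cst].
have m0 (x : R) : 0 <= Num.max x 0 by rewrite le_max lexx orbT.
have phi : (Num.max x 0) @[x --> r] --> within [set s | 0 <= s] (nbhs t).
  move=> A wA; have := cm _ wA.
  rewrite -[X in X -> _]/(\forall x \near r, 0 <= Num.max x 0 -> A (Num.max x 0)).
  rewrite -[X in _ -> X]/(\forall x \near r, A (Num.max x 0)).
  by apply: filterS => x; apply; exact: m0.
have /fine_cvgP[fin cv] := cvg_comp _ _ phi Ht.
apply/cvgrPdist_le => e e0.
have we : 0 < weight g k * e by rewrite mulr_gt0 ?weight_gt0.
move/cvgrPdist_le : cv => /(_ _ we); apply: filterS2 fin => x fin.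
rewrite /= sub0r normrN => le.
rewrite distrC -(ler_pM2l (weight_gt0 g k)).
rewrite -[X in X * _](gtr0_norm (weight_gt0 g k)) -normrM -lee_fin.
apply: le_trans (coordinate_le g (Hsub (p (Num.max x 0)) (p t)) k1) _.
have finE : (fine (Hnorm g (Hsub (p (Num.max x 0)) (p t))))%:E =
  Hnorm g (Hsub (p (Num.max x 0)) (p t)) := fineK fin.
by rewrite -finE lee_fin; exact: le_trans (ler_norm _) le.
Qed.

End coordinates.

(** * Coordinates of Bochner integrals *)

Section bochner_coordinate.
Context {R : realType}.
Local Notation mu := (@lebesgue_measure R).

Lemma cvge0_near_le (U : nat -> \bar R) (e : R) : 0 < e ->
  U n @[n --> \oo] --> 0%E -> \forall n \near \oo, (U n <= e%:E)%E.
Proof.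
move=> e0 /fine_cvgP[fin /cvgrPdist_le /(_ _ e0)]; apply: filterS2 fin => n fin.
by rewrite /= sub0r normrN -[in (_ <= _)%E](fineK fin) lee_fin; exact: le_trans (ler_norm _).
Qed.

Variables (g : R) (D : set (measurableTypeR R)) (k : nat).
Hypotheses (mD : measurable D) (k1 : (1 <= k)%N).

(** Finite measure of the sets of a step function makes each term integrable. *)
Lemma step_fun_coordinate (S : step_fun R) : is_step_fun g D S ->
  mu.-integrable D (fun s => (step_fun_eval S s k)%:E) /\
  (\int[mu]_(s in D) step_fun_eval S s k)%R = step_fun_int S k.
Proof.
move=> HS.
pose f (i : 'I_(sf_size S)) (s : R) := (\1_(sf_set S i) s * sf_val S i k)%:E.
have iA (i : 'I_(sf_size S)) : mu.-integrable D (fun s => (\1_(sf_set S i) s)%:E).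
  have [mA AD Aoo _] := HS i (ltn_ord i).
  apply: (@integrableS _ _ _ mu setT) => //.
  apply/integrableP; split; first exact/measurable_EFinP/measurable_indic.
  under eq_integral do rewrite /= ger0_norm//.
  by rewrite integral_indic// setIT.
have ifi i : mu.-integrable D (f i).
  have -> : f i = (fun s => (\1_(sf_set S i) s)%:E * (sf_val S i k)%:E)%E.
    by apply/funext => s; rewrite /f EFinM.
  exact: integrableZr.
have fE s : (step_fun_eval S s k)%:E = (\sum_(i < sf_size S) f i s)%E.
  by rewrite /step_fun_eval -sumEFin.
split; first by under eq_fun do rewrite fE; exact: integrable_sum.
rewrite /Rintegral; under eq_integral do rewrite fE.
rewrite integral_sum// /step_fun_int.
rewrite (_ : (\sum_(i < sf_size S) _)%E = (\sum_(i < sf_size S)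
  fine (mu (sf_set S i)) * sf_val S i k)%:E)//.
rewrite -sumEFin; apply: eq_bigr => i _.
have [mA AD Aoo _] := HS i (ltn_ord i).
rewrite /f; under eq_integral do rewrite EFinM.
rewrite integralZr// integral_indic// setIidl// EFinM fineK//.
by rewrite ge0_fin_numE.
Qed.

(** A coordinate is a bounded linear form, so it commutes with the limits that
    define the integral. *)
Lemma bochner_coordinate (f : R -> fseries R) (J : fseries R) :
  mu.-integrable D (fun s => (f s k)%:E) -> bochner_integral g D f J ->
  J k = (\int[mu]_(s in D) f s k)%R.
Proof.
move=> fi [_ [S [HS _ cvS cvJ]]].
have c0 := weight_gt0 g k; set c := weight g k in c0.
apply/eqP; rewrite -subr_eq0 -normr_le0; apply/ler_addgt0Pr => e e0; rewrite add0r.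
have ce : 0 < c * e / 2 by rewrite divr_gt0// mulr_gt0.
near \oo => n.
have U : (\int[mu]_(s in D) Hnorm g (Hsub (step_fun_eval (S n) s) (f s)) <=
    (c * e / 2)%:E)%E by near: n; exact: cvge0_near_le cvS.
have V : (Hnorm g (Hsub (step_fun_int (S n)) J) <= (c * e / 2)%:E)%E.
  by near: n; exact: cvge0_near_le cvJ.
have [Si SE] := step_fun_coordinate (HS n).
have Sfi : mu.-integrable D (EFin \o (fun s => step_fun_eval (S n) s k - f s k)).
  have -> : EFin \o (fun s => step_fun_eval (S n) s k - f s k) =
    (fun s => (step_fun_eval (S n) s k)%:E - (f s k)%:E)%E.
    by apply/funext => s /=; rewrite EFinB.
  exact: integrableB.
have h1 : c * `|step_fun_int (S n) k - J k| <= c * e / 2.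
  rewrite -lee_fin -[X in X * _](gtr0_norm c0) -normrM.
  exact: le_trans (coordinate_le g _ k1) V.
have h2 : c * `|step_fun_int (S n) k - (\int[mu]_(s in D) f s k)%R| <= c * e / 2.
  rewrite -SE -RintegralB// -lee_fin EFinM; apply: le_trans U.
  apply: (@le_trans _ _ (c%:E * \int[mu]_(s in D)
      `|step_fun_eval (S n) s k - f s k|%:E)%E).
    apply: lee_wpmul2l; first by rewrite lee_fin ltW.
    have := le_normr_Rintegral mD Sfi.
    rewrite -lee_fin => /le_trans; apply; rewrite fineK//.
    exact: integrable_fin_num (integrable_norm Sfi).
  have mabs := measurable_int mu (integrable_norm Sfi).
  have abs0 s : D s -> (0 <= (EFin \o (Num.norm \o
      (fun s => (step_fun_eval (S n) s k - f s k)%R))) s)%E.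
    by move=> _; rewrite /= lee_fin.
  have := ge0_integralZl_EFin mu mD abs0 mabs (ltW c0). move=> <-.
  apply: ge0_le_lower_integral => s _.
    by apply: mule_ge0; [rewrite lee_fin ltW|rewrite /= lee_fin].
  rewrite -EFinM -[X in X * _](gtr0_norm c0) -normrM.
  exact: (coordinate_le g (Hsub (step_fun_eval (S n) s) (f s)) k1).
rewrite -(ler_pM2l c0).
have : J k - (\int[mu]_(s in D) f s k)%R =
    - (step_fun_int (S n) k - J k) +
    (step_fun_int (S n) k - (\int[mu]_(s in D) f s k)%R) by ring.
move=> ->; apply: le_trans (ler_wpM2l (ltW c0) (ler_normD _ _)) _.
rewrite normrN mulrDr; lra.
Unshelve. all: by end_near. Qed.

End bochner_coordinate.

(** * The scalar equation of a coordinate *)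

Section coordinate_process.
Context {R : realType} {d : measure_display} {Om : measurableType d}.
Variables (P : probability Om R) (F : R -> set (set Om)) (W : R -> Om -> R).
Hypotheses (hF : usual_conditions P F) (hW : brownian_motion P F W).
Local Notation L2 := (Lfun P 2%:E).
Local Notation mu := (@lebesgue_measure R).
Variables (theta g : R) (u I : R -> Om -> fseries R) (k : nat).
Hypothesis k1 : (1 <= k)%N.
Hypothesis um : forall t, 0 <= t -> Hmeasurable (F t) g (u t).
Hypothesis usup : forall T, 0 < T ->
  (\int[P]_w ereal_sup [set Hnorm2 g (u s w) | s in `[0%R, T]] < +oo)%E.
Hypothesis HI : ito_integral P F W g u I.

Variable N : set Om.
Hypotheses (mN : measurable N) (PN : P N = 0%E).
Hypothesis ucont : forall w, ~ N w -> Hcontinuous g (u ^~ w).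
Hypothesis ueq : forall w, ~ N w -> forall t, 0 <= t -> exists2 J : fseries R,
  bochner_integral (g - 1) `[0, t] (fun s => dxx (u s w)) J &
  eq_fseries (fun k => u t w k - theta * J k) (fun k => u 0 w k + I t w k).

Let c := weight g k.
Let ind : Om -> R := \1_(~` N).

(** The factor [weight g k] makes the square of this process at most the squared
    norm of [u], so that the estimates in norm apply without constants. *)
Definition scaled_coord (t : R) (w : Om) : R := ind w * (c * u (Num.max t 0) w k).
Definition scaled_coord_int (t : R) (w : Om) : R := ind w * (c * I t w k).

Let ind01 w : ind w = 0 /\ N w \/ ind w = 1 /\ ~ N w.
Proof.
rewrite /ind indicE; case: (boolP (w \in ~` N)) => [/set_mem|]; first by right.
by rewrite notin_setE => /contrapT; left.
Qed.

(** The null sets belong to the initial sigma-algebra, so that replacing a process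
    by 0 on [N] keeps it adapted. *)
Lemma ind_measurable_wrt t : 0 <= t -> measurable_wrt (F t) ind.
Proof.
move=> t0; apply: measurable_indic.
rewrite /measurable/= (sigma_algebra_id (filtration_sigma hF t0)).
have [_ /(_ _ _ (lexx 0) t0) F0t _ F0N] := hF.
have : F t N by apply/F0t/F0N; exists N; split.
have [_ hC _] := filtration_sigma hF t0.
by move/hC; rewrite setTD.
Qed.

Let u_measurable t : 0 <= t -> measurable_wrt (F t) (fun w => u t w k).
Proof. by move=> t0; exact: Hmeasurable_coordinate k1 (filtration_sigma hF t0) (um t0). Qed.

Lemma scaled_coord_continuous w : continuous (scaled_coord ^~ w).
Proof.
rewrite /scaled_coord; have [[-> _]|[-> Nw]] := ind01 w.
  rewrite (_ : (fun _ => _) = cst 0); first exact: cst_continuous.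
  by apply/funext => t; rewrite mul0r.
have uc := Hcontinuous_coordinate k1 (ucont Nw).
by move=> t; apply: cvgM; [exact: cvg_cst|apply: cvgM; [exact: cvg_cst|exact: uc]].
Qed.

Lemma scaled_coord_adapted t : 0 <= t -> measurable_wrt (F t) (scaled_coord t).
Proof.
move=> t0; apply: measurable_funM; first exact: ind_measurable_wrt.
apply: measurable_funM; first exact: measurable_cst.
by rewrite (max_l t0); exact: u_measurable.
Qed.

Lemma scaled_coord_measurable t : measurable_fun setT (scaled_coord t).
Proof.
have m0 : 0 <= Num.max t 0 by rewrite le_max lexx orbT.
have -> : scaled_coord t = scaled_coord (Num.max t 0).
  by apply/funext => w; rewrite /scaled_coord (max_l m0).
exact: measurable_wrt_measurable (filtration_sigma hF m0)
  (filtration_measurable hF m0) (scaled_coord_adapted m0).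
Qed.

Let sqr_le (v : fseries R) w : (((ind w * (c * v k)) ^+ 2)%:E <= Hnorm2 g v)%E.
Proof.
have h := coordinate_sqr_le g v k1.
have [[-> _]|[-> _]] := ind01 w; last by rewrite mul1r.
by rewrite mul0r expr0n/=; apply: le_trans h; rewrite lee_fin sqr_ge0.
Qed.

(** The squared norm of [u] has an integrable supremum over bounded times. *)
Lemma scaled_coord_bound T : exists m : R,
  forall t, 0 <= t -> t <= T -> (\int[P]_w (scaled_coord t w ^+ 2)%:E <= m%:E)%E.
Proof.
have T1 : 0 < `|T| + 1 by rewrite ltr_wpDl.
have sup_oo := usup T1.
set S := (\int[P]_w _)%E in sup_oo.
have leS t : 0 <= t -> t <= T -> (\int[P]_w (scaled_coord t w ^+ 2)%:E <= S)%E.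
  move=> t0 tT; apply: ge0_le_lower_integral => w _; first by rewrite lee_fin sqr_ge0.
  rewrite /scaled_coord (max_l t0); apply: le_trans (sqr_le _ _) _.
  apply: ereal_sup_ubound; exists t => //=; rewrite in_itv/= t0/=.
  by rewrite (le_trans tT)// (le_trans (ler_norm _))// lerDl.
have [T0|T0] := leP 0 T; last first.
  by exists 0 => t t0 tT; have := le_lt_trans (le_trans t0 tT) T0; rewrite ltxx.
exists (fine S) => t t0 tT; rewrite fineK; first exact: leS.
rewrite ge0_fin_numE//; apply: le_trans (leS 0 (lexx 0) T0).
by apply: integral_ge0 => w _; rewrite lee_fin sqr_ge0.
Qed.

(** The approximating processes are the coordinates of the given ones, and the
    errors are bounded by the errors in norm. *)
Lemma scaled_coord_ito : scalar_ito P F W scaled_coord scaled_coord_int.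
Proof.
have [mI _ SI] := HI; split=> [t t0|T T0].
  apply: measurable_funM; first exact: ind_measurable_wrt.
  apply: measurable_funM; first exact: measurable_cst.
  exact: Hmeasurable_coordinate k1 (filtration_sigma hF t0) (mI t t0).
have [S [HS cvS cvJ]] := SI T T0.
exists (fun n => sp_size (S n)), (fun n => sp_time (S n)),
  (fun n i w => ind w * (c * sp_val (S n) i w k)); split.
- move=> n; have [t0 tS vS] := HS n; split => // i iN.
  have ti0 : 0 <= sp_time (S n) i.
    by elim: {iN} i => // i IH; exact: le_trans (tS i).
  have [mv [C vC]] := vS i iN.
  have mv' : measurable_wrt (F (sp_time (S n) i))
      (fun w => ind w * (c * sp_val (S n) i w k)).
    apply: measurable_funM; first exact: ind_measurable_wrt.
    apply: measurable_funM; first exact: measurable_cst.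
    exact: Hmeasurable_coordinate k1 (filtration_sigma hF ti0) mv.
  have mv'' : measurable_fun setT (fun w => ind w * (c * sp_val (S n) i w k)).
    exact: measurable_wrt_measurable (filtration_sigma hF ti0)
      (filtration_measurable hF ti0) mv'.
  split => //; apply: L2P => //.
  apply: (@le_lt_trans _ _ (\int[P]_w (C ^+ 2)%:E)%E); last first.
    by rewrite integral_cst//= probability_setT mule1 ltry.
  apply: ge0_le_lower_integral => w _; first by rewrite lee_fin sqr_ge0.
  have := le_trans (coordinate_le g (sp_val (S n) i w) k1) (vC w).
  rewrite !lee_fin => vw; have C0 : 0 <= C by exact: le_trans vw.
  have [[-> _]|[-> _]] := ind01 w; first by rewrite mul0r expr0n/= sqr_ge0.
  by rewrite mul1r -(real_normK (num_real _)) lerXn2r// nnegrE.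
- apply: (squeeze_cvge _ (cvg_cst _) cvS); apply: nearW => n; apply/andP; split.
    by apply: integral_ge0 => w _; apply: integral_ge0 => r _; rewrite lee_fin sqr_ge0.
  apply: ge0_le_lower_integral => w _.
    by apply: integral_ge0 => r _; rewrite lee_fin sqr_ge0.
  apply: ge0_le_lower_integral => r; first by rewrite lee_fin sqr_ge0.
  rewrite /= in_itv/= => /andP[r0 _].
  apply: le_trans (sqr_le _ w); rewrite lee_fin /scaled_coord (max_l r0).
  rewrite /Hsub /simple_eval /step_eval 2!mulrBr !mulr_sumr.
  rewrite (_ : \sum_(i < _) _ = \sum_(i < sp_size (S n)) ind w * (c *
    (\1_(`]sp_time (S n) i, sp_time (S n) i.+1]%classic) r * sp_val (S n) i w k)))//.
  by apply: eq_bigr => i _; ring.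
- move=> t t0 tT.
  apply: (squeeze_cvge _ (cvg_cst _) (cvJ t t0 tT)); apply: nearW => n; apply/andP; split.
    by apply: integral_ge0 => w _; rewrite lee_fin sqr_ge0.
  apply: ge0_le_lower_integral => w _; first by rewrite lee_fin sqr_ge0.
  apply: le_trans (sqr_le _ w); rewrite lee_fin /scaled_coord_int.
  rewrite /Hsub /simple_int /step_int 2!mulrBr !mulr_sumr.
  rewrite (_ : \sum_(i < _) _ = \sum_(i < sp_size (S n)) ind w * (c *
    (sp_val (S n) i w k * (W (Num.min t (sp_time (S n) i.+1)) w
                      - W (Num.min t (sp_time (S n) i)) w))))//.
  by apply: eq_bigr => i _; ring.
Qed.

Lemma scaled_coord_equation w t : 0 <= t -> scaled_coord t w = scaled_coord 0 w -
  theta * k%:R ^+ 2 * (\int[mu]_(r in `]0%R, t]) scaled_coord r w)%R + scaled_coord_int t w.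
Proof.
move=> t0; have [[i0 _]|[i1 Nw]] := ind01 w.
  rewrite /scaled_coord /scaled_coord_int i0 !mul0r addr0 sub0r.
  rewrite (_ : (\int[mu]_(r in _) _)%R = 0) ?mulr0 ?oppr0//.
  rewrite -[RHS](Rintegral_set0 mu (fun=> 0)) [RHS]Rintegral_mkcond [LHS]Rintegral_mkcond.
  by apply: eq_Rintegral => r _; rewrite !patchE mul0r; case: ifP; case: ifP.
have [J HJ eqJ] := ueq Nw t0.
have cc : continuous (scaled_coord ^~ w) by exact: scaled_coord_continuous.
have ic : mu.-integrable `[0, t] (EFin \o (scaled_coord ^~ w)).
  apply: continuous_compact_integrable; first exact: segment_compact.
  exact: continuous_subspaceT.
have c0 := weight_gt0 g k; rewrite -/c in c0.
have uE s : s \in `[0, t]%classic -> u s w k = c^-1 * scaled_coord s w.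
  rewrite inE/= in_itv/= => /andP[s0 _].
  by rewrite /scaled_coord i1 mul1r (max_l s0) mulKf// gt_eqF.
have idxx : mu.-integrable `[0, t] (fun s => (dxx (u s w) k)%:E).
  apply: (@eq_integrable _ _ _ mu `[0, t]%classic (measurable_itv _)
    (fun s => (- k%:R ^+ 2 * c^-1)%:E * (scaled_coord s w)%:E)%E).
    by move=> s sI; rewrite /dxx uE// -EFinM [in RHS]mulrA.
  exact: integrableZl.
have JE := bochner_coordinate (measurable_itv `[0, t]) k1 idxx HJ.
have {}JE : c * J k = - k%:R ^+ 2 * (\int[mu]_(r in `]0%R, t]) scaled_coord r w)%R.
  rewrite JE.
  have -> : (\int[mu]_(s in `[0%R, t]) dxx (u s w) k =
      \int[mu]_(s in `[0%R, t]) ((- k%:R ^+ 2 * c^-1) * scaled_coord s w))%R.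
    by apply: eq_Rintegral => s sI; rewrite /dxx uE// [in LHS]mulrA.
  rewrite RintegralZl// mulrA mulrCA mulfV ?gt_eqF// mulr1.
  congr (_ * _); apply/esym; apply: Rintegral_itv_obnd_cbnd.
  exact: continuous_integrable.
set A := (\int[mu]_(r in _) _)%R in JE *.
have cE s : 0 <= s -> scaled_coord s w = c * u s w k.
  by move=> s0; rewrite /scaled_coord i1 mul1r (max_l s0).
rewrite !cE// /scaled_coord_int i1 mul1r.
have -> : c * u t w k = theta * (c * J k) + (c * u 0 w k + c * I t w k).
  have -> : u t w k = theta * J k + (u 0 w k + I t w k).
    by rewrite -(eqJ k k1); ring.
  by ring.
rewrite JE; ring.
Qed.

End coordinate_process.

(** * Explicit form of the coordinates *)

Section explicit_solution.
Context {R : realType} {d : measure_display} {Om : measurableType d}.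
Variables (P : probability Om R) (F : R -> set (set Om)) (W : R -> Om -> R).
Hypotheses (hF : usual_conditions P F) (hW : brownian_motion P F W).

Lemma mean_sqr_eq0 (Z : Om -> R) : Z \in Lfun P 2%:E -> mean P (Z ^+ 2) = 0 ->
  {ae P, forall w, Z w = 0}.
Proof.
move=> Z2 E0; have mZ := L2_measurable Z2.
have mZ2 : measurable_fun setT (fun w => (Z w ^+ 2)%:E).
  by apply/measurable_EFinP; exact: measurable_funX.
have : (\int[P]_w `|(Z w ^+ 2)%:E| = 0)%E.
  under eq_integral do rewrite gee0_abs ?lee_fin ?sqr_ge0//.
  by rewrite integral_sqr// E0.
move/(ae_eq_integral_abs P measurableT mZ2); apply: filterS => w /(_ I) [] /eqP.
by rewrite sqrf_eq0 => /eqP.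
Qed.

(** At each fixed time the difference with the exponential process expands around 0
    and starts from 0, so it vanishes almost surely. This holds simultaneously at all
    rational times, and extends to all times by continuity of both processes. *)
Lemma solution_coordinate (theta g : R) (u : R -> Om -> fseries R) (k : nat) :
  0 <= theta -> (1 <= k)%N -> heat_solution P F W theta g u ->
  {ae P, forall w, forall t, 0 <= t -> u t w k =
    u 0 w k * expR (W t w - W 0 w - (theta * k%:R ^+ 2 + 2^-1) * t)}.
Proof.
move=> theta0 k1 [um uc _ usup [I HI ueq]].
have [N [mN PN sub]] := filterI uc ueq.
have ucont w : ~ N w -> Hcontinuous g (u ^~ w).
  by move=> Nw; apply: contrapT => H; apply/Nw/sub => -[].
have {}ueq w : ~ N w -> forall t, 0 <= t -> exists2 J : fseries R,
  bochner_integral (g - 1) `[0, t] (fun s => dxx (u s w)) J &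
  eq_fseries (fun k => u t w k - theta * J k) (fun k => u 0 w k + I t w k).
  by move=> Nw; apply: contrapT => H; apply/Nw/sub => -[].
pose lam := theta * k%:R ^+ 2.
have lam0 : 0 <= lam by rewrite mulr_ge0// sqr_ge0.
pose X := scaled_coord g u k N.
have cX w : continuous (X ^~ w) := @scaled_coord_continuous _ _ _ g u k k1 N ucont w.
have mX t : measurable_fun setT (X t) by exact: (scaled_coord_measurable hF k1 um mN PN).
have aX t : 0 <= t -> measurable_wrt (F t) (X t).
  exact: (scaled_coord_adapted hF k1 um mN PN).
have bX T : exists m : R,
  forall t, 0 <= t -> t <= T -> (\int[P]_w (X t w ^+ 2)%:E <= m%:E)%E.
  exact: (scaled_coord_bound k1 usup).
have XI := scaled_coord_ito hF k1 HI mN PN.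
have eqX w t : 0 <= t -> X t w = X 0 w -
    lam * (\int[@lebesgue_measure R]_(r in `]0%R, t]) X r w)%R + scaled_coord_int g I k N t w.
  exact: scaled_coord_equation.
have X0 : L2_at P F 0 (X 0) := scalar_L2_at mX aX bX (lexx 0).
pose Y := geometric_motion W lam (X 0).
have Y0 : Y 0 = X 0.
  by apply/funext => w; rewrite /Y /geometric_motion mulr0 !subrr expR0 mulr1.
have XY t : 0 <= t -> {ae P, forall w, X t w = Y t w}.
  rewrite le_eqVlt => /predU1P[<-|t0]; first by apply: aeW => w; rewrite Y0.
  have [C1 C10 e1] := scalar_expands hF hW lam0 cX mX aX bX XI eqX (ltW t0).
  have [C2 C20 e2] := geometric_motion_expands hF hW lam0 X0 (ltW t0).
  have e12 := expandsB e1 e2.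
  have C0 : 0 <= 2 * C1 + 2 * C2 by rewrite addr_ge0// mulr_ge0.
  have Z0 : mean P ((X 0 - Y 0) ^+ 2) = 0.
    by rewrite Y0 subrr expr0n /=; exact: (mean_cst P 0).
  have Zt := expands_eq0 hF hW lam0 C0 t0 e12 Z0.
  have [m _] := e12; have [_ Z2] := m t (ltW t0) (lexx t).
  by apply: filterS (mean_sqr_eq0 Z2 Zt) => w /eqP; rewrite subr_eq0 => /eqP.
have grid (n : nat) : {ae P, forall w, forall z : int, 0 <= z ->
    X (z%:~R / n.+1%:R) w = Y (z%:~R / n.+1%:R) w}.
  have h (m : nat) : {ae P, forall w, X (m%:~R / n.+1%:R) w = Y (m%:~R / n.+1%:R) w}.
    by apply: XY; rewrite divr_ge0// ler0n.
  apply: filterS (ae_foralln h) => w H z z0.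
  by rewrite -(gez0_abs z0); exact: H.
have [_ cW _ _ _] := hW.
have nN : {ae P, forall w, ~ N w} by exists N; split => // w /= /contrapT.
have := ae_foralln grid; move: nN cW; apply: filterS3 => w Nw cw H t t0.
have cY : Y r w @[r --> within `[0, +oo[%classic (nbhs t)] --> Y t w.
  apply: cvgM; first exact: cvg_cst.
  apply: (cvg_comp _ expR); last exact: continuous_expR.
  apply: cvgB; last by apply: cvgM; [exact: cvg_cst|apply: cvg_within_filter; exact: cvg_id].
  apply: cvgB; last exact: cvg_cst.
  by move/subspace_continuousP: cw; apply; rewrite /= in_itv/= t0.
pose grd n : R := (Num.floor (n.+1%:R * t))%:~R / n.+1%:R.
have grd0 n : 0 <= grd n by rewrite divr_ge0// ler0z floor_ge0 mulr_ge0.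
have gt : grd n @[n --> \oo] --> t := @grid_cvg R t.
have gw : grd n @[n --> \oo] -->
    within `[0, +oo[%classic (nbhs t).
  move=> A wA; have := gt _ wA.
  rewrite -[X in X -> _]/(\forall n \near \oo, `[0, +oo[%classic (grd n) -> A (grd n)).
  rewrite -[X in _ -> X]/(\forall n \near \oo, A (grd n)).
  by apply: filterS => n; apply; rewrite /= in_itv/= andbT grd0.
have XYt : X t w = Y t w.
  have c1 := cvg_comp _ _ gw cY; have c2 := cvg_comp _ _ gt (cX w t).
  apply: (cvg_unique (@Rhausdorff R) c2); apply: cvg_trans c1; apply: near_eq_cvg.
  by apply: nearW => n; rewrite /= H// floor_ge0 mulr_ge0.
have XE s : 0 <= s -> X s w = weight g k * u s w k.
  by move=> s0; rewrite /X /scaled_coord indicE mem_set// mul1r (max_l s0).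
move: XYt; rewrite /Y /geometric_motion !XE// -mulrA.
by move/(mulfI (lt0r_neq0 (weight_gt0 g k))).
Qed.

End explicit_solution.

(** * Recovery of the parameter *)

Lemma inv_sqr_cvg0 (R : realType) : (k%:R ^+ 2)^-1 @[k --> \oo] --> (0 : R).
Proof.
have lim1 : (k%:R : R)^-1 @[k --> \oo] --> (0 : R).
  by apply/gtr0_cvgV0; [near=> k; rewrite ltr0n; near: k; exact: nbhs_infty_gt|exact: cvgr_idn].
rewrite (_ : (fun k : nat => (k%:R ^+ 2)^-1) = (fun k : nat => (k%:R : R)^-1 * k%:R^-1)).
  have -> : (0 : R) = 0 * 0 by rewrite mulr0.
  exact: cvgM.
by apply/funext => k; rewrite expr2 invfM.
Unshelve. all: by end_near. Qed.

Lemma ln_decay (R : realType) (x a : R) : x != 0 -> ln (x / (x * expR a)) = - a.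
Proof.
move=> x0; rewrite invfM mulrA mulfV// mul1r -expRN; exact: expRK.
Qed.

Theorem theorem1p1 (R : realType) (d : measure_display) (Om : measurableType d)
    (P : probability Om R) (F : R -> set (set Om)) (W : R -> Om -> R)
    (theta gamma : R) (u0 : fseries R) (u : R -> Om -> fseries R)
    (hF : usual_conditions P F) (hW : brownian_motion P F W)
    (htheta : 0 < theta)
    (hu : heat_solution P F W theta gamma u)
    (hu0H : inH gamma u0)
    (hu0 : {ae P, forall w, eq_fseries (u 0 w) u0})
    (hu0_neq0 : forall k : nat, (1 <= k)%N -> u0 k != 0) :
  [/\ forall k : nat, (1 <= k)%N ->
        {ae P, forall w,
          (k%:R ^+ 2 * T)^-1 * ln (u 0 w k / u T w k) - (2 * k%:R ^+ 2)^-1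
            @[T --> +oo] --> theta},
      forall T : R, 0 < T ->
        {ae P, forall w,
          (k%:R ^+ 2 * T)^-1 * ln (u 0 w k / u T w k) @[k --> \oo] --> theta}
    & forall (T : R) (n k : nat), 0 < T -> (1 <= n)%N -> (1 <= k)%N -> n <> k ->
        {ae P, forall w,
          theta = (T * (k%:R ^+ 2 - n%:R ^+ 2))^-1 *
                  ln ((u T w n * u 0 w k) / (u T w k * u 0 w n))}].
Proof.
pose a (w : Om) (k : nat) (T : R) :=
  W T w - W 0 w - (theta * k%:R ^+ 2 + 2^-1) * T.
have sol k : (1 <= k)%N -> {ae P, forall w, u 0 w k != 0 /\
    forall T, 0 <= T -> u T w k = u 0 w k * expR (a w k T)}.
  move=> k1; have := solution_coordinate hF hW (ltW htheta) k1 hu.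
  move: hu0; apply: filterS2 => w u0w sw; split; last exact: sw.
  by rewrite u0w// hu0_neq0.
have kneq0 k : (1 <= k)%N -> (k%:R : R) != 0 by move=> k1; rewrite pnatr_eq0 -lt0n.
split.
- move=> k k1; have growth := brownian_growth hF hW.
  move: (sol k k1) growth; apply: filterS2 => w [u0w uE] growth.
  have lim : theta - (k%:R ^+ 2)^-1 * ((W T w - W 0 w) / T) @[T --> +oo] --> theta.
    rewrite -[X in _ --> X]subr0 -[X in _ - X](mulr0 ((k%:R ^+ 2)^-1)).
    by apply: cvgB; [exact: cvg_cst|apply: cvgM => //; exact: cvg_cst].
  apply: cvg_trans lim; apply: near_eq_cvg; near=> T.
  have T0 : 0 < T by near: T; exact: nbhs_pinfty_gt.
  rewrite (uE T (ltW T0)) ln_decay// /a; field.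
  by rewrite kneq0// gt_eqF.
- move=> T T0.
  have all_k : {ae P, forall w, forall k, (1 <= k)%N -> u 0 w k != 0 /\
      u T w k = u 0 w k * expR (a w k T)}.
    apply: ae_foralln => k; case: (posnP k) => [->|k1]; first exact: aeW.
    by apply: filterS (sol k k1) => w [u0w uE] _; split => //; rewrite uE// ltW.
  apply: filterS all_k => w uE.
  have lim : theta + (2^-1 - (W T w - W 0 w) / T) * (k%:R ^+ 2)^-1
      @[k --> \oo] --> theta.
    set D := 2^-1 - _.
    suff : theta + D * (k%:R ^+ 2)^-1 @[k --> \oo] --> theta + D * 0.
      by rewrite mulr0 addr0.
    by apply: cvgD; [exact: cvg_cst|apply: cvgM; [exact: cvg_cst|exact: inv_sqr_cvg0]].
  apply: cvg_trans lim; apply: near_eq_cvg; near=> k.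
  have k1 : (1 <= k)%N by near: k; exact: nbhs_infty_gt.
  have [u0w ->] := uE k k1.
  rewrite ln_decay// /a; field.
  by rewrite kneq0// gt_eqF.
- move=> T n k T0 n1 k1 nk; move: (sol n n1) (sol k k1).
  apply: filterS2 => w [un0 unE] [uk0 ukE].
  rewrite (unE T (ltW T0)) (ukE T (ltW T0)).
  have -> : u 0 w n * expR (a w n T) * u 0 w k / (u 0 w k * expR (a w k T) * u 0 w n) =
      expR (a w n T - a w k T).
    by rewrite expRB; field; rewrite un0 uk0 gt_eqF// expR_gt0.
  rewrite expRK /a.
  have kn : (k%:R : R) ^+ 2 - n%:R ^+ 2 != 0.
    rewrite subr_eq0 -!natrX eqr_nat eqn_exp2r//.
    by apply/eqP => kn; apply: nk.
  field.
  by rewrite kn gt_eqF.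
Unshelve. all: by end_near. Qed.
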